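(* Let $d\in\mathbb{N}$ with $d\ge 2$, and let $\mu_1,\dots,\mu_d>0$. Let $\alpha\in\mathopen]0,2\mathclose[$, let $\Sigma\subseteq\mathbb{R}^d\setminus\{0\}$ be an open set such that $\lambda x\in\Sigma$ whenever $x\in\Sigma$ and $\lambda>0$, and let $U\in\mathcal{C}^3(\Sigma,\mathopen]0,+\infty\mathclose[)$ be positively homogeneous of degree $-\alpha$, i.e. $U(\lambda x)=\lambda^{-\alpha}U(x)$ for every $x\in\Sigma$, $\lambda>0$. Let $\xi^+\in\mathcal{E}\cap\Sigma$ be a central configuration for $U$ satisfying the condition $$(\mathrm{BS})\qquad \nu_1>-\frac{(2-\alpha)^2}{8}\,\mathcal{U}(\xi^+),$$ where $\nu_1$ is the smallest eigenvalue of $\nabla^2\mathcal{U}(\xi^+)$. Finally, let $W\in\mathcal{C}^2([0,+\infty[\times\mathcal{T}(\xi^+,R,\eta))$, for some $R>0$ and $\eta\in\mathopen]0,1\mathclose[$, satisfy $$|W(t,x)|+|x|\,|\nabla W(t,x)|+|x|^2\,|\nabla^2W(t,x)|=\mathcal{O}(|x|^{-\beta})\quad\text{for }|x|\to+\infty,\ \text{uniformly in } t,$$ for some $\beta$ such that $4\beta-3\alpha>2$. Then there exist $R'\ge R$ and $\eta'\in[\eta,1[$ such that $\mathcal{T}(\xi^+,R',\eta')\subseteq\Sigma$ and, for every $x_0\in\mathcal{T}(\xi^+,R',\eta')$, there exists a parabolic solution $x\colon[0,+\infty[\to\mathbb{R}^d$ of $$\ddot x=\nabla U(x)+\nabla W(t,x)$$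 satisfying $x(0)=x_0$ and $$\lim_{t\to+\infty}\frac{x(t)}{|x(t)|}=\xi^+.$$ Moreover, $|x(t)|\sim\omega t^{\frac{2}{\alpha+2}}$ for $t\to+\infty$, where $\omega=\bigl((\alpha+2)^2U(\xi^+)/2\bigr)^{\frac{1}{\alpha+2}}$.
   Context: The mass scalar product on $\mathbb{R}^d$ is $\langle x,y\rangle=\sum_{j=1}^d\mu_jx_jy_j$, with norm $|x|=\sqrt{\langle x,x\rangle}$; for a matrix $A$, $|A|=\sup_{|x|\le1}|Ax|$. Gradients $\nabla$ and Hessians $\nabla^2$ (with respect to the space variable $x$) are taken with respect to this scalar product, i.e. with $M=\mathrm{diag}(\mu_1,\dots,\mu_d)$ and $D,D^2$ the Euclidean gradient and Hessian, $\nabla=M^{-1}D$, $\nabla^2=M^{-1}D^2$. Thus the equation reads $\mu_j\ddot x_j=\partial_{x_j}U(x)+\partial_{x_j}W(t,x)$, $j=1,\dots,d$. $\mathcal{E}=\{x\in\mathbb{R}^d: |x|=1\}$ is the inertia ellipsoid and $\mathcal{U}=U|_{\mathcal{E}}$ (defined on $\mathcal{E}\cap\Sigma$). A (normalized) central configuration is a critical point $\xi^+\in\mathcal{E}\cap\Sigma$ of $\mathcal{U}$. $\nabla^2\mathcal{U}(\xi^+)$ is the Hessian of $\mathcal{U}$ at the critical point $\xi^+$ with respect to the metric induced by $\langle\cdot,\cdot\rangle$, a self-adjoint operator on the tangent space $\mathcal{T}_{\xi^+}\mathcal{E}=\{v:\langle v,\xi^+\rangle=0\}$. For $R>0$ and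 $\eta\in\mathopen]0,1\mathclose[$, $\mathcal{T}(\xi^+,R,\eta)=\{x\in\mathbb{R}^d: |x|>R \text{ and } \langle x/|x|,\xi^+\rangle>\eta\}$. A solution $x\colon[0,+\infty[\to\mathbb{R}^d$ (a $\mathcal{C}^2$ function whose values lie where the right-hand side of the equation is defined) is called parabolic if $\lim_{t\to+\infty}|x(t)|=+\infty$ and $\lim_{t\to+\infty}\dot x(t)=0$. The notation $f(t)\sim g(t)$ means $f(t)/g(t)\to1$. *)

(* Defs.v *)
From HB Require Import structures.
From mathcomp Require Import all_boot all_order all_algebra.
From mathcomp Require Import all_classical all_reals all_analysis.
Set Implicit Arguments.
Unset Strict Implicit.
Unset Printing Implicit Defensive.
Import Order.TTheory GRing.Theory Num.Theory numFieldNormedType.Exports.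
Local Open Scope classical_set_scope.
Local Open Scope ring_scope.

Section Smoothness.
Variables (R : realType) (V W : normedModType R).

(* Directional derivatives relative to a set A: the increment h is restricted
   to values with a + h v in A. On an open set these are the library's
   [derivable] and ['D_v]; at a boundary point, such as t = 0 of [0, +oo[,
   they are one-sided derivatives. *)
Definition diff_quotient (f : V -> W) (a v : V) (h : R) : W :=
  h^-1 *: (f (h *: v + a) - f a).

Definition derivable_within (A : set V) (f : V -> W) (a v : V) : Prop :=
  cvg (diff_quotient f a v h @[h --> within [set h | A (h *: v + a)] 0^']).

Definition derive_within (A : set V) (f : V -> W) (a v : V) : W :=
  lim (diff_quotient f a v h @[h --> within [set h | A (h *: v + a)] 0^']).

(* Class C^k on A: all iterated directional derivatives up to order k exist
   and are continuous on A. In finite dimension this agrees with the definition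
   by partial derivatives, for A open and for A = [0, +oo[ or [0, +oo[ x T with
   T open (one-sided derivatives at t = 0, continuous up to t = 0). *)
Fixpoint Ck_on (k : nat) (A : set V) (f : V -> W) : Prop :=
  {within A, continuous f} /\
  if k is k'.+1 then
    forall v : V, (forall a, A a -> derivable_within A f a v) /\
                  Ck_on k' A (fun a => derive_within A f a v)
  else True.

End Smoothness.

Definition half_line (R : realType) : set R := `[0, +oo[.
Arguments half_line R : clear implicits.

Section MassGeometry.
Variables (R : realType) (d : nat) (mu : 'I_d -> R).
Local Notation V := 'cV[R]_d.

Definition mdot (x y : V) : R := \sum_(j < d) mu j * x j 0 * y j 0.

Definition mnorm (x : V) : R := Num.sqrt (mdot x x).

Definition mopnorm (A : 'M[R]_d) : R :=
  sup [set mnorm (A *m x) | x in [set x : V | mnorm x <= 1]].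

Definition basis_vec (j : 'I_d) : V := delta_mx j 0.

Definition mgrad (f : V -> R) (x : V) : V :=
  \col_j ((mu j)^-1 * derive f x (basis_vec j)).

Definition mhess (f : V -> R) (x : V) : 'M[R]_d :=
  \matrix_(i, j) ((mu i)^-1 *
    derive (fun y => derive f y (basis_vec j)) x (basis_vec i)).

Definition ellipsoid : set V := [set x | mnorm x = 1].

Definition tangent_space (xi : V) : set V := [set v | mdot v xi = 0].

(* For x in the ellipsoid, x is the unit normal at x for the mass scalar
   product, so [tproj x] is the orthogonal projection onto the tangent space. *)
Definition tproj (x w : V) : V := w - mdot w x *: x.

(* Gradient, at a point x of the ellipsoid, of the restriction of f to the
   ellipsoid endowed with the induced metric. *)
Definition egrad (f : V -> R) (x : V) : V := tproj x (mgrad f x).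

(* Hessian operator of that restriction: v |-> nabla_v egrad, where nabla is
   the Levi-Civita connection of the ellipsoid, i.e. the tangential projection
   of the ambient derivative. For v tangent at xi, ['D_v] only involves the
   values of [egrad f] on the ellipsoid. *)
Definition ehess (f : V -> R) (xi v : V) : V :=
  tproj xi (derive (egrad f) xi v).

Definition critical_on_ellipsoid (f : V -> R) (xi : V) : Prop :=
  egrad f xi = 0.

Definition central_configuration (Sigma : set V) (U : V -> R) (xi : V) : Prop :=
  [/\ ellipsoid xi, Sigma xi & critical_on_ellipsoid U xi].

Definition ehess_eigenvalues (f : V -> R) (xi : V) : set R :=
  [set a | exists v, [/\ tangent_space xi v, v != 0 & ehess f xi v = a *: v]].

Definition smallest_ehess_eigenvalue (f : V -> R) (xi : V) (nu : R) : Prop :=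
  ehess_eigenvalues f xi nu /\ lbound (ehess_eigenvalues f xi) nu.

Definition cone_region (xi : V) (r eta : R) : set V :=
  [set x | r < mnorm x /\ eta < mdot ((mnorm x)^-1 *: x) xi].

(* |W| + |x||grad W| + |x|^2|Hess W| = O(|x|^-beta) as |x| -> +oo with x in
   [dom], uniformly in t >= 0; gradient and Hessian are in the space variable. *)
Definition uniform_decay (dom : set V) (W : R -> V -> R) (beta : R) : Prop :=
  exists C K : R, forall (t : R) (x : V), 0 <= t -> dom x -> K < mnorm x ->
    `|W t x| + mnorm x * mnorm (mgrad (W t) x)
      + mnorm x ^+ 2 * mopnorm (mhess (W t) x) <= C * mnorm x `^ (- beta).

Definition time_derive (x : R -> V) (t : R) : V :=
  derive_within (half_line R) x t 1.

(* x : [0, +oo[ -> dom of class C^2 solving x'' = grad U(x) + grad W(t, x);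
   the values of x at negative times are irrelevant. *)
Definition solution (dom : set V) (U : V -> R) (W : R -> V -> R)
    (x : R -> V) : Prop :=
  Ck_on 2 (half_line R) x /\
  forall t, 0 <= t -> dom (x t) /\
    time_derive (time_derive x) t = mgrad U (x t) + mgrad (W t) (x t).

Definition parabolic (x : R -> V) : Prop :=
  mnorm (x t) @[t --> +oo] --> +oo /\
  time_derive x t @[t --> +oo] --> (0 : V).

End MassGeometry.

(* Main.v *)
Require Import Defs.
From HB Require Import structures.
From mathcomp Require Import all_boot all_order all_algebra.
From mathcomp Require Import sesquilinear spectral mxred complex.
From mathcomp Require Import all_classical all_reals all_analysis.
From mathcomp Require Import ring lra.
Import Order.TTheory GRing.Theory Num.Theory numFieldNormedType.Exports.
Local Open Scope classical_set_scope.
Local Open Scope ring_scope.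
Set Implicit Arguments.
Unset Strict Implicit.
Unset Printing Implicit Defensive.

(** The unperturbed equation has the parabolic homothetic solution
    omega t^kappa xi with kappa = 2 / (alpha + 2), and the solution wanted is a
    small correction of it. Given x0 of norm lam, let t0 be the time at which
    the homothetic solution has norm lam, and write, with
    tau = ln (1 + t / t0),

      x(t) = lam (e^{kappa tau} xi + phi(tau)),

    so that x(0) = x0 exactly when phi(0) = x0 / lam - xi, which is small if x0
    lies in a thin cone. Put Om = (alpha + 2)^2 U(xi) / 2 and let H be the
    (mass) Hessian of U at xi. By homogeneity of grad U the equation becomes

      phi'' - phi' = B phi + F(tau, phi),     B = H / Om,

    where F collects the second order remainder of grad U at xi and the
    rescaled force of W ([force_identity]).

    H is diagonalizable, with eigenvalue alpha (alpha + 1) U(xi) along xi and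
    nu - alpha U(xi) on the tangent space, nu an eigenvalue of the intrinsic
    Hessian ([hess_mx_diagonalizable]). Condition (BS) says exactly that all
    eigenvalues c of B exceed -1/4, that is, that the indicial equation
    a^2 - a = c has real roots a < 1/2 < 1 - a. Hence for gm in the gap, just
    below 1/2, the linear equation is hyperbolic in the weight e^{gm tau}: with
    a right-hand side O(e^{gm tau}) and a prescribed initial value it has
    exactly one solution O(e^{gm tau}). The force of W contributes
    O(e^{kappa (alpha + 1 - beta) tau}) along the homothetic solution, and
    4 beta - 3 alpha > 2 says exactly that kappa (alpha + 1 - beta) < 1/2, so
    that gm can be chosen above it ([lower_gap]). The Lipschitz constant of F
    is small close to xi and for lam large: for the remainder of grad U because
    U is C^2, and for W because beta > alpha ([force_contraction]). So phi is
    found as the fixed point of a contraction in a ball of the weighted space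
    ([weighted_contraction], [euler_system], [log_solution]).

    Finally gm < 1/2 < kappa makes phi negligible with respect to
    e^{kappa tau}; this gives the limit direction, the growth rate and the
    decay of the velocity ([orbit_direction_cvg], [orbit_growth],
    [orbit_velocity_cvg]). *)

(** * Mean value inequalities in the sup norm *)

Lemma ler_of_eq (R : numDomainType) (x y : R) : x = y -> x <= y.
Proof. by move=> ->. Qed.

Section Norms.
Variables (R : realType) (m n : nat).

Lemma ler_mx_entry (v : 'M[R]_(m, n)) i j : `|v i j| <= `|v|.
Proof.
by rewrite [leRHS]/Num.Def.normr /= mx_normrE; exact: (le_bigmax _ _ (i, j)).
Qed.

Lemma mx_norm_leP (v : 'M[R]_(m, n)) (e : R) : 0 <= e ->
  (forall i j, `|v i j| <= e) -> `|v| <= e.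
Proof.
move=> e0 ve; rewrite [leLHS]/Num.Def.normr /= mx_normrE.
by apply: bigmax_le => // -[i j] _; exact: ve.
Qed.

Lemma mx_norm_ltP (v : 'M[R]_(m, n)) (e : R) : 0 < e ->
  (forall i j, `|v i j| < e) -> `|v| < e.
Proof.
move=> e0 ve; rewrite [ltLHS]/Num.Def.normr /= mx_normrE.
by apply/bigmax_ltP; split => // -[i j] _; exact: ve.
Qed.

End Norms.

Section Lines.
Variables (R : realType) (V W : normedModType R).

Lemma is_derive_line (f : V -> W) (x v : V) (s : R) :
  derivable f (s *: v + x) v ->
  is_derive s 1 (fun s => f (s *: v + x)) ('D_v f (s *: v + x)).
Proof.
have E : (fun h : R => h^-1 *: (f ((h *: (1 : R) + s) *: v + x) - f (s *: v + x)))
   = (fun h : R => h^-1 *: (f (h *: v + (s *: v + x)) - f (s *: v + x))).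
  by apply/funext => h; rewrite scaler1 scalerDl addrA.
by move=> df; split; rewrite /derivable /derive /= E.
Qed.

Lemma is_derive_lineP (f : V -> W) (x v : V) (s : R) (l : W) :
  is_derive s 1 (fun s => f (s *: v + x)) l -> is_derive (s *: v + x) v f l.
Proof.
have E : (fun h : R => h^-1 *: (f ((h *: (1 : R) + s) *: v + x) - f (s *: v + x)))
   = (fun h : R => h^-1 *: (f (h *: v + (s *: v + x)) - f (s *: v + x))).
  by apply/funext => h; rewrite scaler1 scalerDl addrA.
by case; rewrite /derivable /derive /= E => df dE; split.
Qed.

End Lines.

Lemma is_derive_continuous (R : realType) (W : normedModType R) (f : R -> W)
  (x : R) (df : W) : is_derive x 1 f df -> {for x, continuous f}.
Proof.
by case=> fx _; apply/differentiable_continuous/derivable1_diffP.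
Qed.

Section MVT.
Variables (R : realType).

Lemma continuous_within (f : R -> R) (A : set R) :
  (forall x, A x -> {for x, continuous f}) -> {within A, continuous f}.
Proof.
move=> fA; apply/subspace_continuousP => x Ax.
exact: cvg_within_filter (fA _ Ax).
Qed.

Lemma MVT_everywhere (f df : R -> R) (a b : R) : a <= b ->
  (forall x, a <= x <= b -> is_derive x 1 f (df x)) ->
  exists2 c, a <= c <= b & f b - f a = df c * (b - a).
Proof.
move=> ab fab.
have [||c] := @MVT_segment _ f df a b ab; last by exists c.
  by move=> x; rewrite in_itv /= => /andP[ax xb]; apply: fab; rewrite !ltW.
apply: continuous_within => x /=; rewrite in_itv /= => xab.
exact: is_derive_continuous (fab _ xab).
Qed.

Lemma nondecreasing_of_derive (f df : R -> R) (a b : R) : a <= b ->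
  (forall x, a <= x <= b -> is_derive x 1 f (df x)) ->
  (forall x, a <= x <= b -> 0 <= df x) -> f a <= f b.
Proof.
move=> ab fab df0; have [c cab E] := MVT_everywhere ab fab.
by rewrite -subr_ge0 E mulr_ge0 ?subr_ge0// df0.
Qed.

Lemma MVT_unordered (f df : R -> R) (a b : R) :
  (forall x, Num.min a b <= x <= Num.max a b -> is_derive x 1 f (df x)) ->
  exists2 c, Num.min a b <= c <= Num.max a b & f b - f a = df c * (b - a).
Proof.
move=> fab; have [ab|/ltW ba] := leP a b.
  by move: fab; rewrite min_l// max_r// => fab; exact: MVT_everywhere.
move: fab; rewrite min_r// max_l// => fab.
have [c cab E] := MVT_everywhere ba fab.
by exists c => //; rewrite -opprB E -mulrN opprB.
Qed.

End MVT.

Section Box.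
Variables (R : realType) (n : nat).
Local Notation V := 'cV[R]_n.
Local Notation e_ j := (@basis_vec R n j).

Lemma basis_vecE (j i : 'I_n) : (e_ j) i 0 = (i == j)%:R.
Proof. by rewrite mxE eqxx andbT. Qed.

(** Moving from x to y one coordinate at a time stays in the sup-norm ball, so
    the one-variable mean value theorem applies to each step with the partial
    derivatives. *)
Lemma box_mvt (f : V -> R) (c : V) (rho m : R) (L : 'I_n -> R) :
  (forall z, `|z - c| < rho -> forall j,
     derivable f z (e_ j) /\ `|'D_(e_ j) f z - L j| <= m) ->
  forall x y, `|x - c| < rho -> `|y - c| < rho ->
  `|f y - f x - \sum_j L j * (y j 0 - x j 0)|
    <= m * \sum_j `|y j 0 - x j 0|.
Proof.
move=> fL x y xc yc.
have rho0 : 0 < rho by exact: le_lt_trans xc.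
(* the k-th corner of the path: its first k coordinates are those of y *)
pose z (k : nat) : V := \col_j (if (j < k)%N then y j 0 else x j 0).
have z0 : z 0 = x by apply/matrixP => i j; rewrite mxE ord1.
have zn : z n = y by apply/matrixP => i j; rewrite mxE ltn_ord ord1.
have step (k : 'I_n) : `|f (z k.+1) - f (z k) - L k * (y k 0 - x k 0)|
    <= m * `|y k 0 - x k 0|.
  set D := y k 0 - x k 0.
  have zkS : z k.+1 = D *: e_ k + z k.
    apply/matrixP => i j; rewrite (ord1 j) !mxE eqxx andbT ltnS leq_eqVlt.
    have [->|ik] := eqVneq i k; first by rewrite eqxx ltnn mulr1 subrK.
    by rewrite (_ : (i == k :> nat) = false)?mulr0 ?add0r//; exact/negbTE.
  have zk0 : z k = 0 *: e_ k + z k by rewrite scale0r add0r.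
  have near_c (s : R) : Num.min 0 D <= s <= Num.max 0 D ->
      `|s *: e_ k + z k - c| < rho.
    move=> sD; apply: mx_norm_ltP => // i j; rewrite (ord1 j).
    have xi := le_lt_trans (ler_mx_entry (x - c) i 0) xc.
    have yi := le_lt_trans (ler_mx_entry (y - c) i 0) yc.
    move: xi yi sD; rewrite /D !mxE eqxx andbT.
    have [->|ik] := eqVneq i k.
      rewrite ltnn mulr1 !ltr_norml => /andP[x1 x2] /andP[y1 y2].
      by case: (leP 0 (y k 0 - x k 0)) => _ /andP[s1 s2]; apply/andP; split; lra.
    by rewrite mulr0 add0r; case: ifP.
  have [s sD E] := @MVT_unordered R (fun s => f (s *: e_ k + z k))
     (fun s => 'D_(e_ k) f (s *: e_ k + z k)) 0 D
     (fun s sD => is_derive_line (fL _ (near_c s sD) k).1).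
  rewrite zkS {2}zk0 E subr0 -mulrBl normrM ler_wpM2r//.
  exact: (fL _ (near_c s sD) k).2.
have -> : f y - f x - \sum_j L j * (y j 0 - x j 0) =
    \sum_(k < n) (f (z k.+1) - f (z k) - L k * (y k 0 - x k 0)).
  rewrite sumrB; congr (_ - _).
  by rewrite -(big_mkord xpredT (fun k => f (z k.+1) - f (z k)))
     telescope_sumr// z0 zn.
apply: le_trans (ler_norm_sum _ _ _) _.
by rewrite mulr_sumr; apply: ler_sum.
Qed.

Lemma box_mvt_norm (f : V -> R) (c : V) (rho m : R) (L : 'I_n -> R) :
  (forall z, `|z - c| < rho -> forall j,
     derivable f z (e_ j) /\ `|'D_(e_ j) f z - L j| <= m) ->
  forall x y, `|x - c| < rho -> `|y - c| < rho ->
  `|f y - f x - \sum_j L j * (y j 0 - x j 0)| <= m * n%:R * `|y - x|.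
Proof.
move=> fL x y xc yc; apply: le_trans (box_mvt fL xc yc) _.
have [->|/eqP] := eqVneq y x.
  by rewrite subrr normr0 mulr0 big1 ?mulr0// => j _; rewrite subrr normr0.
move=> yx; have [j] : exists j : 'I_n, true.
  apply/not_existsP => n0; apply: yx; apply/matrixP => i.
  by case: (n0 i).
move=> _; have m0 : 0 <= m by apply: le_trans (fL _ xc j).2.
rewrite -mulrA ler_wpM2l// mulr_natl.
rewrite -[X in _ *+ X]card_ord -sumr_const; apply: ler_sum => k _.
by have := ler_mx_entry (y - x) k 0; rewrite !mxE.
Qed.

(** Continuity of the partial derivatives at x makes the error in [box_mvt_norm]
    o(|h v|), which gives every directional derivative and its linearity in the
    direction. *)
Lemma derive_partials (f : V -> R) (x : V) :
  (\forall z \near x, forall j, derivable f z (e_ j)) ->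
  (forall j, {for x, continuous ('D_(e_ j) f)}) ->
  forall v, is_derive x v f (\sum_j 'D_(e_ j) f x * v j 0).
Proof.
move=> fd fc v.
set l := \sum_j _.
suff H : h^-1 *: (f (h *: v + x) - f x) @[h --> 0^'] --> l.
  split; first by apply/cvg_ex; exists l.
  by apply: cvg_lim.
apply/cvgrPdist_le => e e0.
have [E E0 Ee] : exists2 E, 0 < E & E * n%:R * `|v| <= e.
  have N0 : 0 <= n%:R * `|v| by rewrite mulr_ge0.
  exists (e / (n%:R * `|v| + 1)); first by rewrite divr_gt0// ltr_wpDl.
  rewrite -mulrA mulrAC ler_pdivrMr ?ltr_wpDl//.
  by apply: ler_wpM2l; [exact: ltW|rewrite lerDl].
have : \forall z \near x, forall j, derivable f z (e_ j) /\
    `|'D_(e_ j) f z - 'D_(e_ j) f x| <= E.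
  have fcE : \forall z \near x, forall j, `|'D_(e_ j) f x - 'D_(e_ j) f z| <= E.
    by apply: (@filter_forall _ _ (fun j z => `|'D_(e_ j) f x - 'D_(e_ j) f z| <= E) (nbhs x)) => j;
    have /cvgrPdist_le/(_ _ E0) := fc j.
  by apply: filterS2 fd fcE => z dz cz j; split; rewrite // distrC.
case/nbhs_ballP => rho /= rho0 B.
have B' z : `|z - x| < rho -> forall j, derivable f z (e_ j) /\
    `|'D_(e_ j) f z - 'D_(e_ j) f x| <= E.
  by move=> zx; apply: B; rewrite -ball_normE /= distrC.
have vx : \forall h \near (0 : R)^', `|h *: v| < rho.
  have : h *: v @[h --> (0 : R)] --> (0 *: v).
    exact: scalel_continuous.
  rewrite scale0r => /cvgrPdist_lt/(_ _ rho0) H.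
  by apply: cvg_within; apply: filterS H => h; rewrite sub0r normrN.
near=> h.
have h0 : h != 0 by near: h; exact: nbhs_dnbhs_neq.
have := @box_mvt_norm f x rho E _ B' x (h *: v + x).
rewrite subrr normr0 addrK => /(_ rho0).
have hv : `|h *: v| < rho by near: h.
move=> /(_ hv) H.
have -> : l - h^-1 *: (f (h *: v + x) - f x) = - (h^-1 *:
   (f (h *: v + x) - f x - \sum_j 'D_(e_ j) f x * ((h *: v + x) j 0 - x j 0))).
  have -> : \sum_j 'D_(e_ j) f x * ((h *: v + x) j 0 - x j 0) = h * l.
    by rewrite /l mulr_sumr; apply: eq_bigr => j _; rewrite !mxE addrK mulrCA.
  move: (f (h *: v + x) - f x) => w.
  by change (l - h^-1 * w = - (h^-1 * (w - h * l))); rewrite mulrBr mulKf// opprB.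
rewrite normrN normrZ normfV ler_pdivrMl ?normr_gt0//.
apply: le_trans H _; rewrite normrZ.
by rewrite mulrCA ler_wpM2l.
Unshelve. all: by end_near. Qed.

End Box.

(** * Equality of mixed second derivatives *)

Section Schwarz.
Variables (R : realType) (V : normedModType R).

Lemma continuous_near_le (T : topologicalType) (W : normedModType R) (f : T -> W)
  (x : T) (e : R) :
  {for x, continuous f} -> 0 < e -> \forall z \near x, `|f z - f x| <= e.
Proof.
move=> /cvgrPdist_le fx e0.
by apply: filterS (fx e e0) => z; rewrite distrC.
Qed.

(** The second difference over the parallelogram of sides h v and h w is
    evaluated by the mean value theorem along v and then along w. It is symmetric
    in v and w, which is the source of [derive_comm]. *)
Lemma second_difference (f : V -> R) (x v w : V) (rho h L E : R) :
  0 <= h -> h * (`|v| + `|w|) < rho ->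
  (forall z, `|z - x| < rho -> [/\ derivable f z v, derivable ('D_v f) z w &
    `|'D_w ('D_v f) z - L| <= E]) ->
  `|(f (h *: v + (h *: w + x)) - f (h *: v + x)) - (f (h *: w + x) - f x)
    - h ^+ 2 * L| <= h ^+ 2 * E.
Proof.
move=> h0 hrho H.
have inb (s t : R) : 0 <= s <= h -> 0 <= t <= h ->
    `|s *: v + (t *: w + x) - x| < rho.
  move=> /andP[s0 sh] /andP[t0 th]; rewrite addrA addrK.
  apply: le_lt_trans hrho; apply: le_trans (ler_normD _ _) _.
  by rewrite !normrZ mulrDr (ger0_norm s0) (ger0_norm t0) lerD ?ler_wpM2r.
have hh : 0 <= h <= h by rewrite h0 lexx.
have h00 : 0 <= (0 : R) <= h by rewrite lexx h0.
pose g s := f (s *: v + (h *: w + x)) - f (s *: v + x).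
have gd s : 0 <= s <= h -> is_derive s 1 g
   ('D_v f (s *: v + (h *: w + x)) - 'D_v f (s *: v + x)).
  move=> sh; apply: is_deriveB; apply: is_derive_line.
    by have [] := H _ (inb s h sh hh).
  by have := inb s 0 sh h00; rewrite scale0r add0r => /H[].
have [s sh gE] := MVT_everywhere h0 gd.
pose k r := 'D_v f (r *: w + (s *: v + x)).
have kd r : 0 <= r <= h -> is_derive r 1 k ('D_w ('D_v f) (r *: w + (s *: v + x))).
  move=> rh; apply: is_derive_line; rewrite addrCA.
  by have [] := H _ (inb s r sh rh).
have [r rh kE] := MVT_everywhere h0 kd.
have -> : f (h *: v + (h *: w + x)) - f (h *: v + x) - (f (h *: w + x) - f x)
   = g h - g 0 by rewrite /g !scale0r !add0r.
rewrite gE subr0.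
have -> : 'D_v f (s *: v + (h *: w + x)) - 'D_v f (s *: v + x) = k h - k 0.
  by rewrite /k scale0r add0r; congr ('D_v f _ - _); rewrite addrCA.
rewrite kE subr0 -mulrA -expr2 mulrC -mulrBr normrM ger0_norm ?sqr_ge0//.
rewrite ler_wpM2l ?sqr_ge0//.
by have := inb s r sh rh; rewrite addrCA => /H[].
Qed.

Lemma derive_comm (f : V -> R) (x v w : V) :
  (\forall z \near x, [/\ derivable f z v, derivable f z w,
     derivable ('D_v f) z w & derivable ('D_w f) z v]) ->
  {for x, continuous ('D_w ('D_v f))} -> {for x, continuous ('D_v ('D_w f))} ->
  'D_w ('D_v f) x = 'D_v ('D_w f) x.
Proof.
move=> fd cwv cvw; set L1 := LHS; set L2 := RHS.
apply/eqP; rewrite -subr_eq0 -normr_le0; apply/ler_addgt0Pr => e e0.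
have e20 : 0 < e / 2 by rewrite divr_gt0.
have : \forall z \near x, [/\ derivable f z v, derivable f z w,
     derivable ('D_v f) z w & derivable ('D_w f) z v] /\
   (`|'D_w ('D_v f) z - L1| <= e / 2 /\ `|'D_v ('D_w f) z - L2| <= e / 2).
  apply: filterI; first exact: fd.
  exact: filterI (continuous_near_le cwv e20) (continuous_near_le cvw e20).
case/nbhs_ballP => rho /= rho0 B.
(* one parallelogram, inside the ball where both mixed derivatives are within
   e / 2 of their values at x *)
pose h := rho / (`|v| + `|w| + 1).
have N0 : 0 < `|v| + `|w| + 1 by rewrite ltr_wpDl// addr_ge0.
have h0 : 0 < h by rewrite divr_gt0.
have hrho : h * (`|v| + `|w|) < rho.
  by rewrite /h mulrAC ltr_pdivrMr// ltr_pM2l// ltrDl.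
have inB z : `|z - x| < rho -> ball x rho z by rewrite -ball_normE /= distrC.
have H1 := @second_difference f x v w rho h L1 (e / 2) (ltW h0) hrho _.
have H2 := @second_difference f x w v rho h L2 (e / 2) (ltW h0) _ _.
have {}H1 := H1 (fun z zx => let: conj (And4 a b c d) (conj p q) := B z (inB z zx)
   in And3 a c p).
rewrite addrC in hrho.
have {}H2 := H2 hrho (fun z zx => let: conj (And4 a b c d) (conj p q) := B z (inB z zx)
   in And3 b d q).
rewrite add0r -(ler_pM2l (_ : 0 < h ^+ 2)) ?exprn_gt0//.
clear B; clearbody L1 L2.
move: H1 H2; rewrite (addrCA (h *: w)).
move: (f (h *: v + _)) (f (h *: v + x)) (f (h *: w + x)) (f x) => a b c d H1 H2.
rewrite -{1}(ger0_norm (sqr_ge0 h)) -normrM.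
have -> : h ^+ 2 * (L1 - L2) = (a - c - (b - d) - h ^+ 2 * L2)
   - (a - b - (c - d) - h ^+ 2 * L1) by ring.
apply: le_trans (ler_normB _ _) _.
by rewrite [in X in _ <= X](splitr e) mulrDr; exact: lerD.
Qed.

End Schwarz.

(** * Functions of class C^k on open sets and on the half line *)

Section Ck.
Variables (R : realType) (V W : normedModType R).

(** A relative difference quotient reads values of the function in A only. *)
Lemma derive_within_ext (A : set V) (f g : V -> W) (a v : V) :
  (forall a, A a -> f a = g a) -> A a ->
  (derivable_within A f a v = derivable_within A g a v) *
  (derive_within A f a v = derive_within A g a v).
Proof.
move=> fg Aa; rewrite /derivable_within /derive_within.
have E (f1 g1 : V -> W) : (forall a, A a -> f1 a = g1 a) ->
    \forall h \near within [set h | A (h *: v + a)] 0^',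
    diff_quotient f1 a v h = diff_quotient g1 a v h.
  move=> fg1; rewrite near_withinE; apply: nearW => h /= Ah.
  by rewrite /diff_quotient !fg1.
suff -> : diff_quotient f a v h @[h --> within [set h | A (h *: v + a)] 0^'] =
   diff_quotient g a v h @[h --> within [set h | A (h *: v + a)] 0^'] by [].
apply/seteqP; split; apply: near_eq_cvg; apply: E => // b Ab.
by rewrite fg.
Qed.

Lemma Ck_on_ext k (A : set V) (f g : V -> W) :
  (forall a, A a -> f a = g a) -> Ck_on k A f -> Ck_on k A g.
Proof.
elim: k A f g => [|k IH] A f g fg /=.
  case=> fc _; split => //.
  by apply: (subspace_eq_continuous _ fc) => x; rewrite inE => /fg.
case=> fc fk; split.
  by apply: (subspace_eq_continuous _ fc) => x; rewrite inE => /fg.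
move=> v; have [d1 d2] := fk v; split.
  by move=> a Aa; have := d1 a Aa; rewrite (derive_within_ext _ fg Aa).
by apply: (IH _ _ _ _ d2) => a Aa; rewrite (derive_within_ext _ fg Aa).
Qed.

Lemma within_filterE (T : Type) (F : set_system T) (D : set T) :
  Filter F -> F D -> within D F = F.
Proof.
move=> FF FD; apply/seteqP; split => P; rewrite /within /=.
  by move=> FP; apply: filterS2 FD FP => x Dx; apply.
by apply: filterS.
Qed.

Lemma line_near (A : set V) (a v : V) : nbhs a A ->
  \forall h \near (0 : R)^', A (h *: v + a).
Proof.
move=> Aa; apply: cvg_within.
have : h *: v + a @[h --> (0 : R)] --> 0 *: v + a.
  by apply: cvgD; [exact: scalel_continuous|exact: cvg_cst].
by rewrite scale0r add0r; apply.
Qed.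

Lemma derive_within_open (A : set V) (f : V -> W) (a v : V) :
  open A -> A a ->
  (derivable_within A f a v = derivable f a v) *
  (derive_within A f a v = 'D_v f a).
Proof.
move=> oA Aa.
have E : within [set h | A (h *: v + a)] (0 : R)^' = (0 : R)^'.
  by apply: within_filterE; apply: line_near; exact: open_nbhs_nbhs.
by rewrite /derivable_within /derive_within E.
Qed.

Lemma Ck_on_open0 k (A : set V) (f : V -> W) : open A -> Ck_on k A f ->
  forall a, A a -> {for a, continuous f}.
Proof.
move=> oA H; have : {within A, continuous f} by case: k H => [|k] [].
by rewrite continuous_open_subspace// => fc a Aa; apply: fc; rewrite inE.
Qed.

Lemma Ck_on_openS k (A : set V) (f : V -> W) : open A -> Ck_on k.+1 A f ->
  forall v, (forall a, A a -> derivable f a v) /\ Ck_on k A ('D_v f).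
Proof.
move=> oA [fc fk] v; have [d1 d2] := fk v; split.
  by move=> a Aa; have := d1 a Aa; rewrite derive_within_open.
by apply: Ck_on_ext d2 => a Aa; rewrite derive_within_open.
Qed.

Lemma Ck_on_le k (A : set V) (f : V -> W) : Ck_on k.+1 A f -> Ck_on k A f.
Proof.
elim: k f => [|k IH] f /=; first by case.
case=> fc fk; split => // v; have [d1 d2] := fk v; split => //.
exact: IH.
Qed.

End Ck.

Section CkHalfLine.
Variables (R : realType) (W : normedModType R).

(** Admissible increments exist for every direction v, also at a = 0 (on one
    side) and for v = 0; hence relative limits on the half line are unique. *)
Lemma half_line_proper (a v : R) : 0 <= a ->
  ProperFilter (within [set h : R | half_line R (h *: v + a)] 0^').
Proof.
move=> a0; apply: Build_ProperFilter_ex.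
move=> P; rewrite /within /= /dnbhs /within /= => /nbhs_ballP[e /= e0 eP].
pose h := if 0 <= v then e / 2 else - (e / 2).
have e2 : 0 < e / 2 by rewrite divr_gt0.
exists h; apply: eP.
- rewrite -ball_normE /= sub0r normrN /h.
  by case: ifP => _; rewrite ?normrN gtr0_norm// ltr_pdivrMr// ltr_pMr// ltr1n.
- by rewrite /h; case: ifP => _; rewrite ?oppr_eq0 gt_eqF.
- rewrite /half_line /= in_itv /= andbT /h /GRing.scale /=.
  case: ifPn => [v0|]; first by rewrite addr_ge0// mulr_ge0// ltW.
  by rewrite -ltNge => v0; rewrite addr_ge0// nmulr_rge0 ?ltW// oppr_lt0.
Qed.

Lemma is_derive_scale (x : R -> W) (a v : R) (l : W) :
  is_derive a 1 x l -> is_derive a v x (v *: l).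
Proof.
move=> xl; have [xd xE] := xl.
have df : differentiable x a by exact/derivable1_diffP.
split; first exact: diff_derivable.
rewrite deriveE// -[X in 'd x a X]mulr1 (_ : v * 1 = v *: (1 : R))// linearZ.
by rewrite -deriveE// xE.
Qed.

Lemma derive_within_half_line (x : R -> W) (a v : R) (l : W) : 0 <= a ->
  is_derive a 1 x l ->
  derivable_within (half_line R) x a v /\ derive_within (half_line R) x a v = v *: l.
Proof.
move=> a0 /(is_derive_scale v)[xd xE].
have P := half_line_proper v a0.
have C : diff_quotient x a v h @[h --> within [set h | half_line R (h *: v + a)] 0^']
    --> v *: l.
  by rewrite -xE; apply: cvg_within_filter; exact: xd.
split; first by apply/cvg_ex; exists (v *: l).
by apply: cvg_lim.
Qed.

Lemma Ck_on_half_lineS k (x x' : R -> W) :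
  (forall a : R, 0 <= a -> is_derive a 1 x (x' a)) ->
  (forall v : R, Ck_on k (half_line R) (fun a => v *: x' a)) ->
  Ck_on k.+1 (half_line R) x.
Proof.
move=> xd x'k; split.
  apply/subspace_continuousP => a; rewrite /half_line /= in_itv /= andbT => a0.
  apply: cvg_within_filter; apply/differentiable_continuous/derivable1_diffP.
  by case: (xd a a0).
move=> v; split.
  move=> a; rewrite /half_line /= in_itv /= andbT => a0.
  exact: (derive_within_half_line v a0 (xd a a0)).1.
apply: Ck_on_ext (x'k v) => a; rewrite /half_line /= in_itv /= andbT => a0.
by rewrite (derive_within_half_line v a0 (xd a a0)).2.
Qed.

(** The one-sided derivatives at 0 agree with two-sided ones as soon as the
    latter exist, so a function twice differentiable on a neighbourhood of each
    point of the half line can be handled with ordinary derivatives. *)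
Lemma Ck2_half_line (x x1 x2 : R -> W) :
  (forall a : R, 0 <= a -> is_derive a 1 x (x1 a)) ->
  (forall a : R, 0 <= a -> is_derive a 1 x1 (x2 a)) ->
  (forall a : R, 0 <= a -> {for a, continuous x2}) ->
  [/\ Ck_on 2 (half_line R) x,
      forall a : R, 0 <= a -> derive_within (half_line R) x a 1 = x1 a &
      forall a : R, 0 <= a -> derive_within (half_line R)
        (fun t => derive_within (half_line R) x t 1) a 1 = x2 a].
Proof.
move=> d1 d2 c2; split.
- apply: (Ck_on_half_lineS d1) => v.
  apply: (@Ck_on_half_lineS _ _ (fun a => v *: x2 a)).
    by move=> a a0; apply: is_deriveZ; exact: d2.
  move=> w; split=> //.
  apply/subspace_continuousP => a; rewrite /half_line /= in_itv /= andbT => a0.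
  have c : {for a, continuous (fun b : R => w *: (v *: x2 b))}.
    have g : continuous (fun y : W => w *: (v *: y)).
      by move=> y; apply: continuous_comp; exact: scaler_continuous.
    exact: continuous_comp (c2 a a0) (g _).
  exact: cvg_within_filter c.
- by move=> a a0; rewrite (derive_within_half_line 1 a0 (d1 a a0)).2 scale1r.
- move=> a a0.
  have P := half_line_proper 1 a0.
  rewrite -[RHS]scale1r -(derive_within_half_line 1 a0 (d2 a a0)).2.
  rewrite (@derive_within_ext _ _ _ _ _ x1)//.
    move=> b; rewrite /half_line /= in_itv /= andbT => b0.
    by rewrite (derive_within_half_line 1 b0 (d1 _ b0)).2 scale1r.
  by rewrite /half_line /= in_itv /= andbT.
Qed.

End CkHalfLine.

(** * First order scalar equations in an exponential weight *)

Section ScalarDerive.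
Variable R : realType.
Implicit Types (f g : R -> R).

Lemma is_deriveMr f g (x df dg : R) : is_derive x 1 f df -> is_derive x 1 g dg ->
  is_derive x 1 (fun t => f t * g t) (df * g x + f x * dg).
Proof.
move=> fd gd; have -> : df * g x + f x * dg = f x *: dg + g x *: df.
  by rewrite /GRing.scale /= addrC [df * _]mulrC.
exact: is_deriveM.
Qed.

Lemma is_derive_expRM (k x : R) :
  is_derive x 1 (fun t => expR (k * t)) (k * expR (k * x)).
Proof.
have h : is_derive x 1 (fun t : R => k * t) k.
  by rewrite -[X in is_derive _ _ _ X]mulr1; exact: is_deriveZ.
by rewrite mulrC; exact: is_derive1_comp.
Qed.

Lemma continuous_expRM (k : R) : continuous (fun t => expR (k * t)).
Proof. by move=> x; exact: is_derive_continuous (is_derive_expRM k x). Qed.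

Lemma primitive_exists f (a : R) :
  (forall x, a <= x -> {for x, continuous f}) ->
  exists F, forall x, a < x -> is_derive x 1 F (f x).
Proof.
move=> fc.
exists (fun x => \int[@lebesgue_measure R]_(t in [set` `[a, x]]) (f t))%R.
move=> x ax.
have xx1 : x < x + 1 by rewrite ltrDl.
have fi : (@lebesgue_measure R).-integrable `[a, x + 1] (EFin \o f).
  apply: continuous_compact_integrable; first exact: segment_compact.
  apply: continuous_within => y /=; rewrite in_itv /= => /andP[ay _].
  exact: fc.
have [d e] := continuous_FTC1_closed xx1 fi ax (fc x (ltW ax)).
split; [exact: d|by rewrite -derive1E; exact: e].
Qed.

(** The bound e^{k t} >= 1 + k t makes the time |C| / (e k) sufficient. *)
Lemma expR_small (k C e : R) : 0 < k -> 0 < e ->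
  exists2 t, 0 <= t & C * expR (- k * t) <= e.
Proof.
move=> k0 e0.
exists (`|C| / (e * k)); first by rewrite divr_ge0// mulr_ge0// ltW.
rewrite (le_trans (ler_wpM2r (expR_ge0 _) (ler_norm C)))//.
rewrite mulNr expRN ler_pdivrMr ?expR_gt0//.
apply: le_trans (ler_wpM2l (ltW e0) (expR_ge1Dx _)).
rewrite (_ : k * _ = `|C| / e); last by field; rewrite !gt_eqF.
by rewrite mulrDr mulr1 mulrCA divff ?gt_eqF// mulr1 lerDr ltW.
Qed.

(** A derivative dominated by C e^{-k x} is integrable at infinity. Instead of an
    improper integral, f - (C/k) e^{-k x} increases, f + (C/k) e^{-k x} decreases,
    and L is the number that separates their values. *)
Lemma primitive_tail f (g : R -> R) (C k : R) : 0 < k ->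
  (forall x : R, 0 <= x -> is_derive x 1 f (g x)) ->
  (forall x : R, 0 <= x -> `|g x| <= C * expR (- k * x)) ->
  exists L : R, forall x : R, 0 <= x -> `|f x - L| <= C / k * expR (- k * x).
Proof.
move=> k0 fg gC.
pose lo x := f x - C / k * expR (- k * x).
pose up x := f x + C / k * expR (- k * x).
have kN : k != 0 by rewrite gt_eqF.
have hd (x : R) : is_derive x 1 (fun x => C / k * expR (- k * x)) (- C * expR (- k * x)).
  have -> : - C * expR (- k * x) = C / k * (- k * expR (- k * x)) by field.
  by apply: is_deriveZ; exact: is_derive_expRM.
have loM (x y : R) : 0 <= x -> x <= y -> lo x <= lo y.
  move=> x0 xy; apply: (@nondecreasing_of_derive _ lo
    (fun x => g x - (- C * expR (- k * x))) _ _ xy).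
    move=> z /andP[xz _]; apply: is_deriveB; apply: fg; exact: le_trans xz.
  move=> z /andP[xz _]; have := gC z (le_trans x0 xz).
  by rewrite ler_norml => /andP[+ _]; lra.
have upM (x y : R) : 0 <= x -> x <= y -> up y <= up x.
  move=> x0 xy; rewrite -lerN2; apply: (@nondecreasing_of_derive _ (fun x => - up x)
    (fun x => - (g x + (- C * expR (- k * x)))) _ _ xy).
    move=> z /andP[xz _]; apply: is_deriveN; apply: is_deriveD; apply: fg.
    exact: le_trans xz.
  move=> z /andP[xz _]; have := gC z (le_trans x0 xz).
  by rewrite ler_norml => /andP[_ +]; lra.
have C0 : 0 <= C.
  by have := le_trans (normr_ge0 _) (gC 0 (lexx 0)); rewrite pmulr_lge0// expR_gt0.
have lo_up (x : R) : lo x <= up x.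
  have : 0 <= C / k * expR (- k * x).
    by rewrite mulr_ge0 ?expR_ge0// divr_ge0// ltW.
  by rewrite /lo /up; lra.
have lu (x y : R) : 0 <= x -> 0 <= y -> lo x <= up y.
  move=> x0 y0; have [xy|/ltW yx] := leP x y.
    exact: le_trans (loM _ _ x0 xy) (lo_up y).
  exact: le_trans (lo_up x) (upM _ _ y0 yx).
pose A := [set lo x | x in [set x | 0 <= x]].
exists (sup A) => x x0.
have supA : has_sup A.
  split; first by exists (lo 0), 0; rewrite //= lexx.
  by exists (up 0) => _ [y /= y0 <-]; exact: lu.
have L1 : lo x <= sup A by apply: ub_le_sup; [case: supA|exists x].
have L2 : sup A <= up x.
  by apply: ge_sup; [case: supA|move=> _ [y /= y0 <-]; exact: lu].
by rewrite ler_norml; apply/andP; split; move: L1 L2; rewrite /lo /up; lra.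
Qed.

End ScalarDerive.

Section HyperbolicLine.
Variable R : realType.
Implicit Types (f p q : R -> R).

Lemma is_derive_expRM_mul (k l : R) p (x dp : R) : is_derive x 1 p (l * p x + dp) ->
  is_derive x 1 (fun t => expR (k * t) * p t) (expR (k * x) * ((k + l) * p x + dp)).
Proof.
move=> pd; have -> : expR (k * x) * ((k + l) * p x + dp) =
  k * expR (k * x) * p x + expR (k * x) * (l * p x + dp) by ring.
by apply: is_deriveMr pd; exact: is_derive_expRM.
Qed.

(** The solutions of p' = b p + f differ by multiples of e^{b x}, which leave the
    weight gm < b. Membership in the weighted space therefore determines p, and
    the size M of the a priori bound drops out of the conclusion. *)
Lemma unstable_estimate (b gm C M : R) f p : gm < b ->
  (forall x : R, 0 <= x -> is_derive x 1 p (b * p x + f x)) ->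
  (forall x : R, 0 <= x -> `|f x| <= C * expR (gm * x)) ->
  (forall x : R, 0 <= x -> `|p x| <= M * expR (gm * x)) ->
  forall x : R, 0 <= x -> `|p x| <= C / (b - gm) * expR (gm * x).
Proof.
move=> gb pd fC pM.
have k0 : 0 < b - gm by rewrite subr_gt0.
have expE (x : R) : expR (- (b - gm) * x) = expR (- b * x) * expR (gm * x).
  by rewrite -expRD; congr expR; ring.
have expK (x : R) : expR (b * x) * expR (- b * x) = 1.
  by rewrite -expRD mulNr subrr expR0.
have [|x x0|L HL] := @primitive_tail _ (fun x => expR (- b * x) * p x)
    (fun x => expR (- b * x) * f x) C (b - gm) k0.
- move=> x x0; have := @is_derive_expRM_mul (- b) b p x (f x) (pd x x0).
  by rewrite addNr mul0r add0r.
- rewrite normrM (ger0_norm (expR_ge0 _)) expE mulrCA ler_wpM2l ?expR_ge0//.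
  exact: fC.
have L0 : L = 0.
  apply/eqP; rewrite -normr_le0; apply/ler_addgt0Pr => e e0; rewrite add0r.
  have [x x0 xe] := expR_small (C / (b - gm) + M) k0 e0.
  apply: le_trans xe; rewrite mulrDl.
  rewrite (_ : L = expR (- b * x) * p x - (expR (- b * x) * p x - L)); last by ring.
  apply: le_trans (ler_normB _ _) _; rewrite addrC lerD ?HL//.
  by rewrite normrM (ger0_norm (expR_ge0 _)) expE mulrCA ler_wpM2l ?expR_ge0 ?pM.
move=> x x0; have := HL x x0.
rewrite L0 subr0 normrM (ger0_norm (expR_ge0 _)) expE mulrCA.
by rewrite ler_pM2l ?expR_gt0.
Qed.

(** The free solution e^{a x} stays inside the weight since a < gm, so the initial
    value can be prescribed and only enters additively. *)
Lemma stable_estimate (a gm D : R) p q : a < gm ->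
  (forall x : R, 0 <= x -> is_derive x 1 q (a * q x + p x)) ->
  (forall x : R, 0 <= x -> `|p x| <= D * expR (gm * x)) ->
  forall x : R, 0 <= x -> `|q x| <= (`|q 0| + D / (gm - a)) * expR (gm * x).
Proof.
move=> ag qd pD x x0.
set k := gm - a.
have k0 : 0 < k by rewrite subr_gt0.
have kN : k != 0 by rewrite gt_eqF.
have D0 : 0 <= D.
  by have := le_trans (normr_ge0 _) (pD 0 (lexx 0)); rewrite pmulr_lge0// expR_gt0.
have expE (z : R) : expR (k * z) = expR (- a * z) * expR (gm * z).
  by rewrite -expRD; congr expR; rewrite /k; ring.
pose h x := expR (- a * x) * q x.
have hd (z : R) : 0 <= z -> is_derive z 1 h (expR (- a * z) * p z).
  move=> z0; have := @is_derive_expRM_mul (- a) a q z (p z) (qd z z0).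
  by rewrite addNr mul0r add0r.
(* w dominates the variation of h: both w - h and w + h are nondecreasing *)
pose w x := D / k * expR (k * x).
have wd (z : R) : is_derive z 1 w (D * expR (k * z)).
  have -> : D * expR (k * z) = D / k * (k * expR (k * z)) by field.
  by apply: is_deriveZ; exact: is_derive_expRM.
have hw (z : R) : 0 <= z -> `|expR (- a * z) * p z| <= D * expR (k * z).
  move=> z0; rewrite normrM (ger0_norm (expR_ge0 _)) expE mulrCA.
  by rewrite ler_wpM2l ?expR_ge0 ?pD.
have up : w 0 - h 0 <= w x - h x.
  apply: (@nondecreasing_of_derive _ (fun x => w x - h x)
    (fun z => D * expR (k * z) - expR (- a * z) * p z) _ _ x0).
    by move=> z /andP[z0 _]; apply: is_deriveB; exact: hd.
  by move=> z /andP[z0 _]; have := hw z z0; rewrite ler_norml => /andP[_]; lra.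
have dn : w 0 + h 0 <= w x + h x.
  apply: (@nondecreasing_of_derive _ (fun x => w x + h x)
    (fun z => D * expR (k * z) + expR (- a * z) * p z) _ _ x0).
    by move=> z /andP[z0 _]; apply: is_deriveD; exact: hd.
  by move=> z /andP[z0 _]; have := hw z z0; rewrite ler_norml => /andP[+ _]; lra.
have w0 : 0 <= w 0 by rewrite /w mulr_ge0 ?expR_ge0// divr_ge0// ltW.
have h0 : h 0 = q 0 by rewrite /h mulr0 expR0 mul1r.
have hx : `|h x| <= `|q 0| + w x.
  have := ler_norm (q 0); have := ler_norm (- q 0); rewrite normrN.
  by rewrite ler_norml; move: up dn; rewrite h0 => *; apply/andP; split; lra.
have e1 : 1 <= expR (k * x) by rewrite -expR0 ler_expR mulr_ge0// ltW.
have : `|h x| <= (`|q 0| + D / k) * expR (k * x).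
  apply: le_trans hx _; rewrite mulrDl lerD2r.
  by rewrite ler_peMr.
rewrite /h normrM (ger0_norm (expR_ge0 _)) expE mulrCA.
by rewrite ler_pM2l ?expR_gt0.
Qed.

(** Since (D - b)(D - a) q = f is triangular in (q, p) with p = q' - a q, it is
    solved in two steps: p is the one solution that is not excited in the direction
    e^{b x}, and then q starts from q0. *)
Lemma hyperbolic_exists (a b gm C q0 : R) f : a < gm -> gm < b ->
  (forall x : R, {for x, continuous f}) ->
  (forall x : R, 0 <= x -> `|f x| <= C * expR (gm * x)) ->
  exists q p, [/\ q 0 = q0,
    forall x : R, -1 < x -> is_derive x 1 q (a * q x + p x),
    forall x : R, -1 < x -> is_derive x 1 p (b * p x + f x) &
    forall x : R, 0 <= x -> `|p x| <= C / (b - gm) * expR (gm * x)].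
Proof.
move=> ag gb fc fC.
have k0 : 0 < b - gm by rewrite subr_gt0.
have expK (k x : R) : expR (k * x) * expR (- k * x) = 1.
  by rewrite -expRD mulNr subrr expR0.
have expE (x : R) : expR (- (b - gm) * x) = expR (- b * x) * expR (gm * x).
  by rewrite -expRD; congr expR; ring.
have gc x : {for x, continuous (fun x => expR (- b * x) * f x)}.
  by apply: continuousM; [exact: continuous_expRM|exact: fc].
(* starting the primitives left of 0 makes the derivatives two-sided at 0 *)
have [P Pd] := @primitive_exists _ (fun x => expR (- b * x) * f x) (-2)
  (fun x _ => gc x).
have [||L HL] := @primitive_tail _ P (fun x => expR (- b * x) * f x) C (b - gm) k0.
- by move=> x x0; apply: Pd; lra.
- move=> x x0; rewrite normrM (ger0_norm (expR_ge0 _)) expE mulrCA.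
  by rewrite ler_wpM2l ?expR_ge0 ?fC.
pose p x := expR (b * x) * (P x - L).
have pd (x : R) : -2 < x -> is_derive x 1 p (b * p x + f x).
  move=> x2.
  have d1 : is_derive x 1 (fun x => P x - L) (expR (- b * x) * f x).
    rewrite -[X in is_derive _ _ _ X]subr0; apply: is_deriveB.
    exact: Pd.
  have := is_deriveMr (is_derive_expRM b x) d1.
  by rewrite mulrA expK mul1r -mulrA.
have gc2 (x : R) : -1 <= x -> {for x, continuous (fun x => expR (- a * x) * p x)}.
  move=> x1; apply: continuousM; first exact: continuous_expRM.
  by apply: (is_derive_continuous (pd x _)); lra.
have [Q Qd] := @primitive_exists _ (fun x => expR (- a * x) * p x) (-1) gc2.
exists (fun x => expR (a * x) * (Q x - (Q 0 - q0))), p; split.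
- by rewrite mulr0 expR0 mul1r subKr.
- move=> x x1.
  have d1 : is_derive x 1 (fun x => Q x - (Q 0 - q0)) (expR (- a * x) * p x).
    rewrite -[X in is_derive _ _ _ X]subr0; apply: is_deriveB.
    exact: Qd.
  have := is_deriveMr (is_derive_expRM a x) d1.
  by rewrite mulrA expK mul1r -mulrA.
- by move=> x x1; apply: pd; lra.
- move=> x x0; rewrite /p normrM (ger0_norm (expR_ge0 _)).
  have -> : C / (b - gm) * expR (gm * x) =
     expR (b * x) * (C / (b - gm) * expR (- (b - gm) * x)).
    by rewrite expE mulrCA !mulrA -[_ * expR (- b * x)]mulrA -mulrA mulrA expK; ring.
  by rewrite ler_wpM2l ?expR_ge0 ?HL.
Qed.

End HyperbolicLine.

(** * Contractions of a weighted ball *)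

Section WeightedContraction.
Variables (R : realType) (T : topologicalType) (dim : nat).
Local Notation V := 'cV[R]_dim.
Variables (w : T -> R) (e : R) (Phi : (T -> V) -> (T -> V)).
Hypotheses (w0 : forall t, 0 < w t) (wc : continuous w) (e0 : 0 <= e).

(** Continuity is part of the ball because the operator to be iterated solves
    differential equations whose right-hand side is built from g. *)
Definition weighted_ball (g : T -> V) :=
  continuous g /\ forall t, `|g t| <= e * w t.

Hypothesis PhiG : forall g, weighted_ball g -> weighted_ball (Phi g).
Hypothesis PhiL : forall g h D, weighted_ball g -> weighted_ball h ->
  (forall t, `|g t - h t| <= D * w t) ->
  forall t, `|Phi g t - Phi h t| <= D / 2 * w t.

Let u n := iter n Phi (fun=> 0).

Lemma half_pow_small (C d : R) : 0 < d -> exists N, C * 2^-1 ^+ N <= d.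
Proof.
move=> d0.
have h : `|2^-1 : R| < 1 by rewrite ger0_norm ?invr_ge0// invf_lt1// ltr1n.
have C1 : 0 < `|C| + 1 by rewrite ltr_wpDl.
have := cvg_expr h => /cvgrPdist_le /(_ (d / (`|C| + 1))).
rewrite divr_gt0// => /(_ isT)[N _ /(_ N (leqnn N))] /=.
rewrite sub0r normrN ger0_norm ?exprn_ge0 ?invr_ge0// => H.
exists N; apply: le_trans (_ : (`|C| + 1) * 2^-1 ^+ N <= d).
  by rewrite ler_wpM2r ?exprn_ge0 ?invr_ge0// (le_trans (ler_norm C))// lerDl.
by rewrite mulrC -ler_pdivlMr.
Qed.

Let uG n : weighted_ball (u n).
Proof.
elim: n => [|n IH]; last exact: PhiG.
split; first by move=> t; exact: cvg_cst.
by move=> t; rewrite normr0 mulr_ge0// ltW.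
Qed.

Let uS n t : `|u n.+1 t - u n t| <= e * 2^-1 ^+ n * w t.
Proof.
elim: n t => [|n IH] t.
  by rewrite subr0 expr0 mulr1; have [_] := uG 1.
rewrite exprSr mulrA.
exact: PhiL (uG n.+1) (uG n) _ _.
Qed.

Let uD n k t : `|u (n + k) t - u n t| <= (2 * e * 2^-1 ^+ n - 2 * e * 2^-1 ^+ (n + k)) * w t.
Proof.
elim: k => [|k IH]; first by rewrite addn0 !subrr normr0 mul0r.
rewrite addnS -(subrKA (u (n + k) t)); apply: le_trans (ler_normD _ _) _.
apply: le_trans (lerD (uS _ _) IH) _.
rewrite -mulrDl; apply: ler_wpM2r; first exact: ltW.
apply: ler_of_eq.
by rewrite exprS; field.
Qed.

Let uB n m t : (n <= m)%N -> `|u m t - u n t| <= 2 * e * 2^-1 ^+ n * w t.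
Proof.
move=> nm; rewrite -(subnKC nm); apply: le_trans (uD _ _ _) _.
apply: ler_wpM2r; first exact: ltW.
by rewrite gerBl !mulr_ge0 ?exprn_ge0 ?invr_ge0.
Qed.

(** Banach's fixed point theorem for the norm sup |g| / w. The iterates from 0
    converge pointwise with a geometric rate relative to w; since w is continuous
    this rate is locally uniform, and the limit is again continuous. *)
Lemma weighted_contraction : exists g, weighted_ball g /\ forall t, Phi g t = g t.
Proof.
have small t d : 0 < d -> exists N, 2 * e * 2^-1 ^+ N * w t <= d.
  move=> d0; have [N HN] := half_pow_small (2 * e) (divr_gt0 d0 (w0 t)).
  by exists N; rewrite -ler_pdivlMr.
have cu t : cvg (u n t @[n --> \oo]).
  apply/cauchy_cvgP/cauchy_exP => d d0.
  have [N HN] := small t (d / 2) (divr_gt0 d0 (ltr0Sn _ 1)).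
  exists (u N t), N => // n /= Nn; rewrite -ball_normE /= distrC.
  by apply: le_lt_trans (uB t Nn) _; lra.
pose g t := lim (u n t @[n --> \oo]).
have gu n t : `|g t - u n t| <= 2 * e * 2^-1 ^+ n * w t.
  apply/ler_addgt0Pr => d d0.
  have /cvgrPdist_le/(_ d d0)[N _ HN] : u n t @[n --> \oo] --> g t := cu t.
  rewrite -(subrKA (u (maxn N n) t)); apply: le_trans (ler_normD _ _) _.
  by rewrite addrC lerD ?uB ?leq_maxr//; apply: HN => /=; exact: leq_maxl.
have gG : weighted_ball g.
  split; last first.
    move=> t; apply/ler_addgt0Pr => d d0.
    have [N HN] := small t d d0.
    rewrite -(subrK (u N t) (g t)); apply: le_trans (ler_normD _ _) _.
    by rewrite addrC lerD//; [have [_] := uG N|exact: le_trans (gu N t) _].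
  (* at nearby points w is at most 2 w t, so the error at these points is at
     most twice the bound at t *)
  move=> t; apply/cvgrPdist_le => d d0.
  have [N HN] := small t (d / 6) (divr_gt0 d0 (ltr0Sn _ 5)).
  have [uc _] := uG N.
  have ut : \forall s \near t, `|u N s - u N t| <= d / 3.
    by apply: continuous_near_le (uc t) _; rewrite divr_gt0.
  have wt : \forall s \near t, w s <= 2 * w t.
    have := @continuous_near_le _ _ R w t _ (@wc t) (w0 t); apply: filterS => s.
    by rewrite ler_norml => /andP[_]; lra.
  apply: filterS2 ut wt => s us ws.
  have gs : `|g s - u N s| <= d / 3.
    apply: le_trans (gu N s) _.
    have c0 : 0 <= 2 * e * 2^-1 ^+ N by rewrite !mulr_ge0 ?exprn_ge0 ?invr_ge0.
    apply: le_trans (ler_wpM2l c0 ws) _.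
    by rewrite mulrCA; lra.
  have gt : `|g t - u N t| <= d / 3 by apply: le_trans (gu N t) _; lra.
  have -> : g t - g s = (g t - u N t) - (u N s - u N t) - (g s - u N s).
    by rewrite opprB addrA subrK opprB addrA subrK.
  apply: le_trans (ler_normB _ _) _.
  apply: le_trans (lerD (ler_normB _ _) (lexx _)) _.
  lra.
exists g; split => // t.
apply/eqP; rewrite -subr_eq0 -normr_le0; apply/ler_addgt0Pr => d d0; rewrite add0r.
have [N HN] := small t (d / 2) (divr_gt0 d0 (ltr0Sn _ 1)).
have PN := PhiL gG (uG N) (gu N) t.
rewrite -(subrKA (u N.+1 t)); apply: le_trans (ler_normD _ _) _.
have c0 : 0 <= 2 * e * 2^-1 ^+ N * w t.
  by apply: mulr_ge0 (ltW (w0 t)); rewrite !mulr_ge0 ?exprn_ge0 ?invr_ge0.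
have := gu N.+1 t; rewrite distrC exprSr !mulrA => gN.
move: PN; rewrite -/(u N.+1) => PN.
apply: le_trans (lerD PN gN) _.
by rewrite -mulrDl; lra.
Qed.

End WeightedContraction.

(** * Second order systems with an exponential dichotomy *)

Section Clamp.
Variable R : realType.

(** Functions of logarithmic time matter for x >= 0 only; precomposing with the
    retraction of the line onto the half line makes them continuous on the whole
    line, where topology and primitives are simpler. *)
Definition clamp (x : R) : R := Num.max x 0.

Lemma clamp_ge0 x : 0 <= clamp x.
Proof. by rewrite /clamp le_max lexx orbT. Qed.

Lemma clampE x : 0 <= x -> clamp x = x.
Proof. by move=> x0; rewrite /clamp max_l. Qed.

Lemma continuous_clamp : continuous clamp.
Proof.
move=> x; apply: (@continuous_max _ _ (fun x : R => x) (fun=> 0) x).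
  exact: cvg_id.
exact: cvg_cst.
Qed.

End Clamp.

Section ColumnDerive.
Variables (R : realType) (n : nat).
Local Notation V := 'cV[R]_n.

Lemma is_derive_col (E : normedModType R) (q : E -> V) (x v : E) (l : V) :
  (forall i, is_derive x v (fun t => q t i 0) (l i 0)) <-> is_derive x v q l.
Proof.
split=> [H|[qd ql] i].
  have qd : derivable q x v.
    by apply/derivable_mxP => i j; rewrite (ord1 j); have [] := H i.
  split=> //; rewrite derive_mx//; apply/matrixP => i j; rewrite mxE (ord1 j).
  by have [_] := H i.
split; first by move/derivable_mxP : qd; apply.
by rewrite -ql derive_mx// mxE.
Qed.

Lemma continuous_coord (T : topologicalType) (q : T -> V) i : continuous q ->
  continuous (fun t => q t i 0).
Proof.
move=> qc t; apply: (@continuous_comp _ _ _ q (fun M : V => M i 0)).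
  exact: qc.
exact: coord_continuous.
Qed.

End ColumnDerive.

Section Dichotomy.
Variables (R : realType) (n : nat) (a : 'I_n -> R) (gm k : R).
Local Notation V := 'cV[R]_n.
Hypotheses (k0 : 0 < k) (ak : forall i, k <= gm - a i)
  (bk : forall i, k <= 1 - a i - gm).
Implicit Types (f q p : R -> V).

(** With p = q' - a q, this is the decoupled second order system
    (D - (1 - a_i)) (D - a_i) q_i = f_i, that is, q_i'' - q_i' + a_i (1 - a_i) q_i =
    f_i. *)
Definition dichotomy_solution f q p := forall i (x : R), -1 < x ->
  is_derive x 1 (fun t => q t i 0) (a i * q x i 0 + p x i 0) /\
  is_derive x 1 (fun t => p t i 0) ((1 - a i) * p x i 0 + f x i 0).

Definition weight_le f (C : R) := forall x : R, 0 <= x ->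
  `|f x| <= C * expR (gm * x).

Lemma weight_le_ge0 f C : weight_le f C -> 0 <= C.
Proof.
move=> fC; have := le_trans (normr_ge0 _) (fC 0 (lexx 0)).
by rewrite pmulr_lge0// expR_gt0.
Qed.

Lemma weight_le_coord f C i (x : R) : weight_le f C -> 0 <= x ->
  `|f x i 0| <= C * expR (gm * x).
Proof. by move=> fC x0; apply: le_trans (ler_mx_entry _ _ _) (fC x x0). Qed.

Lemma weight_le_col f C : 0 <= C -> (forall i (x : R), 0 <= x ->
  `|f x i 0| <= C * expR (gm * x)) -> weight_le f C.
Proof.
move=> C0 H x x0; apply: mx_norm_leP => [|i j].
  by rewrite mulr_ge0 ?expR_ge0.
by rewrite (ord1 j); exact: H.
Qed.

Let pos1 (x : R) : 0 <= x -> -1 < x.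
Proof. by move=> x0; lra. Qed.

(** One factor 1/k for each of the two first order equations, k being the distance
    from gm to the exponents a_i and 1 - a_i. *)
Lemma dichotomy_estimate f q p C M : dichotomy_solution f q p ->
  weight_le f C -> weight_le p M ->
  weight_le p (C / k) /\ weight_le q (`|q 0| + C / k ^+ 2).
Proof.
move=> sol fC pM.
have C0 := weight_le_ge0 fC.
have pC : weight_le p (C / k).
  apply: weight_le_col; first by rewrite divr_ge0// ltW.
  move=> i x x0.
  have gb : gm < 1 - a i by have := bk i; have := k0; lra.
  have := @unstable_estimate _ (1 - a i) gm C M (fun x => f x i 0)
    (fun x => p x i 0) gb (fun x x0 => (sol i x (pos1 x0)).2)
    (fun x => weight_le_coord i fC) (fun x => weight_le_coord i pM) x x0.
  move=> /le_trans; apply; apply: ler_wpM2r; first exact: expR_ge0.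
  by rewrite ler_wpM2l// lef_pV2 ?posrE ?subr_gt0.
split=> //; apply: weight_le_col.
  by apply: addr_ge0 => //; apply: divr_ge0 => //; exact: sqr_ge0.
move=> i x x0.
have ag : a i < gm by have := ak i; have := k0; lra.
have := @stable_estimate _ (a i) gm (C / k) (fun x => p x i 0)
    (fun x => q x i 0) ag (fun x x0 => (sol i x (pos1 x0)).1)
    (fun x => weight_le_coord i pC) x x0.
move=> /le_trans; apply; apply: ler_wpM2r; first exact: expR_ge0.
apply: lerD; first exact: ler_mx_entry.
rewrite expr2 invfM mulrA ler_wpM2l ?divr_ge0 ?(ltW k0)//.
by rewrite lef_pV2 ?posrE ?subr_gt0.
Qed.

Lemma dichotomy_solutionB f q p f' q' p' :
  dichotomy_solution f q p -> dichotomy_solution f' q' p' ->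
  dichotomy_solution (fun x => f x - f' x) (fun x => q x - q' x)
    (fun x => p x - p' x).
Proof.
move=> s s' i x x1; have [d1 d2] := s i x x1; have [d1' d2'] := s' i x x1.
have E (g g' : R -> V) : (fun t => (g t - g' t) i 0) =
    (fun t => g t i 0 - g' t i 0) by apply/funext => t; rewrite !mxE.
rewrite !E !mxE; split.
  have -> : a i * (q x i 0 - q' x i 0) + (p x i 0 - p' x i 0) =
    (a i * q x i 0 + p x i 0) - (a i * q' x i 0 + p' x i 0) by ring.
  exact: is_deriveB.
have -> : (1 - a i) * (p x i 0 - p' x i 0) + (f x i 0 - f' x i 0) =
  ((1 - a i) * p x i 0 + f x i 0) - ((1 - a i) * p' x i 0 + f' x i 0) by ring.
exact: is_deriveB.
Qed.

Lemma dichotomy_exists f C (q0 : V) : continuous f -> weight_le f C ->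
  exists q p, [/\ q 0 = q0, dichotomy_solution f q p & exists M, weight_le p M].
Proof.
move=> fc fC; have C0 := weight_le_ge0 fC.
have /choice[q qH] : forall i, exists qp : (R -> R) * (R -> R),
    [/\ qp.1 0 = q0 i 0,
    forall x : R, -1 < x -> is_derive x 1 qp.1 (a i * qp.1 x + qp.2 x),
    forall x : R, -1 < x -> is_derive x 1 qp.2 ((1 - a i) * qp.2 x + f x i 0) &
    forall x : R, 0 <= x -> `|qp.2 x| <= C / k * expR (gm * x)].
  move=> i.
  have ag : a i < gm by have := ak i; have := k0; lra.
  have gb : gm < 1 - a i by have := bk i; have := k0; lra.
  have [q [p [e1 e2 e3 e4]]] := @hyperbolic_exists _ (a i) (1 - a i) gm C (q0 i 0)
    (fun x => f x i 0) ag gb (@continuous_coord _ _ _ f i fc)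
    (fun x => weight_le_coord i fC).
  exists (q, p); split => // x x0.
  move: (e4 x x0) => /= /le_trans; apply; apply: ler_wpM2r; first exact: expR_ge0.
  by rewrite ler_wpM2l// lef_pV2 ?posrE ?subr_gt0.
exists (fun x => \col_i (q i).1 x), (fun x => \col_i (q i).2 x); split.
- by apply/matrixP => i j; rewrite mxE (ord1 j); have [] := qH i.
- move=> i x x1.
  have E (g : 'I_n -> R -> R) : (fun t => (\col_i g i t) i 0) = g i.
    by apply/funext => t; rewrite mxE.
  rewrite (E (fun i => (q i).1)) (E (fun i => (q i).2)) !mxE.
  by have [_ h1 h2 _] := qH i; split; [exact: h1|exact: h2].
- exists (C / k); apply: weight_le_col; first by rewrite divr_ge0// ltW.
  by move=> i x x0; rewrite mxE; have [_ _ _] := qH i; apply.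
Qed.

Lemma dichotomy_continuous f q p (x : R) : dichotomy_solution f q p -> -1 < x ->
  {for x, continuous q}.
Proof.
move=> sol x1; apply: (@is_derive_continuous _ V _ _ (\col_i (a i * q x i 0 + p x i 0))).
by apply/is_derive_col => i; rewrite mxE; have [] := sol i x x1.
Qed.

End Dichotomy.

Section DichotomyFixedPoint.
Variables (R : realType) (n : nat) (a : 'I_n -> R) (gm k : R).
Local Notation V := 'cV[R]_n.
Hypotheses (k0 : 0 < k) (ak : forall i, k <= gm - a i)
  (bk : forall i, k <= 1 - a i - gm).

(** The solution operator f |-> q has norm at most 1 / k^2, hence the Lipschitz constant
    k^2 / 2 makes the composition with the superposition operator a contraction of
    ratio 1/2. The fractions e / 4 leave room for |q0| + |F(., 0)| / k^2 + e / 2 <= e. *)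
Lemma dichotomy_fixed_point (F : R -> V -> V) (e : R) (q0 : V) : 0 <= e ->
  (forall g : R -> V, continuous g ->
     (forall x : R, 0 <= x -> `|g x| <= e * expR (gm * x)) ->
     continuous (fun x => F (clamp x) (g (clamp x)))) ->
  (forall (x : R) (u v : V), 0 <= x -> `|u| <= e * expR (gm * x) ->
     `|v| <= e * expR (gm * x) -> `|F x u - F x v| <= k ^+ 2 / 2 * `|u - v|) ->
  (forall x : R, 0 <= x -> `|F x 0| <= k ^+ 2 * (e / 4) * expR (gm * x)) ->
  `|q0| <= e / 4 ->
  exists q p : R -> V, [/\ q 0 = q0,
    dichotomy_solution a (fun x => F (clamp x) (q (clamp x))) q p,
    weight_le gm q e & exists M, weight_le gm p M].
Proof.
move=> e0 Fc Fl F0 q0e.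
pose w x := expR (gm * clamp x).
have w0 x : 0 < w x by exact: expR_gt0.
have wc : continuous w.
  move=> x; apply: (@continuous_comp _ _ _ (@clamp R) (fun y => expR (gm * y))).
    exact: continuous_clamp.
  exact: continuous_expRM.
have k20 : 0 < k ^+ 2 by rewrite exprn_gt0.
have k2N : k ^+ 2 != 0 by rewrite gt_eqF.
have kN : k != 0 by rewrite gt_eqF.
pose f (g : R -> V) x := F (clamp x) (g (clamp x)).
have wE (x : R) : 0 <= x -> w x = expR (gm * x) by move=> x0; rewrite /w clampE.
pose wb (g : R -> V) := @weighted_ball R R n w e g.
have wbE (g : R -> V) : wb g ->
    forall x : R, 0 <= x -> `|g x| <= e * expR (gm * x).
  by move=> [_ gw] x x0; rewrite -wE.
have fC (g : R -> V) : wb g -> weight_le gm (f g) (k ^+ 2 * (e / 4 * 3)).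
  move=> gw x x0; rewrite /f clampE// -[F x (g x)](subrK (F x 0)).
  have gx := wbE g gw x x0.
  have b1 := Fl x (g x) 0 x0 gx; rewrite normr0 subr0 in b1.
  have := lerD (b1 _) (F0 x x0) => b2.
  apply: le_trans (ler_normD _ _) _; apply: le_trans (b2 _) _.
    by rewrite mulr_ge0 ?expR_ge0.
  have k2h : 0 <= k ^+ 2 / 2 by rewrite divr_ge0// ltW.
  have := ler_wpM2l k2h gx => b3.
  apply: le_trans (lerD b3 (lexx _)) _.
  by apply: ler_of_eq; field.
(* one solution for each right-hand side f g; the value outside the ball is
   arbitrary *)
have /choice[S SH] : forall g, exists qp : (R -> V) * (R -> V), wb g ->
    [/\ qp.1 0 = q0, dichotomy_solution a (f g) qp.1 qp.2
      & exists M, weight_le gm qp.2 M].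
  move=> g; have [gw|ngw] := pselect (wb g); last first.
    by exists (fun=> 0, fun=> 0).
  have fc : continuous (f g) by apply: Fc; [case: gw|exact: wbE].
  have [q [p H]] := dichotomy_exists k0 ak bk q0 fc (fC g gw).
  by exists (q, p).
pose Phi g x := (S g).1 (clamp x).
have q0C : `|q0| + k ^+ 2 * (e / 4 * 3) / k ^+ 2 <= e.
  rewrite (_ : k ^+ 2 * (e / 4 * 3) / k ^+ 2 = e / 4 * 3); last by rewrite mulrC mulKf.
  by have := q0e; lra.
have PhiG g : wb g -> wb (Phi g).
  move=> gw; have [S0 Ssol [M SM]] := SH g gw; split.
    move=> x; apply: (@continuous_comp _ _ _ (@clamp R) (S g).1).
      exact: continuous_clamp.
    apply: (dichotomy_continuous Ssol).
    by apply: lt_le_trans (clamp_ge0 x); rewrite oppr_lt0.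
  move=> x; have [_ H] := dichotomy_estimate k0 ak bk Ssol (fC g gw) SM.
  apply: le_trans (H _ (clamp_ge0 x)) _.
  by apply: ler_wpM2r; [exact: expR_ge0|rewrite S0].
have PhiL g h D : wb g -> wb h ->
    (forall t, `|g t - h t| <= D * w t) ->
    forall t, `|Phi g t - Phi h t| <= D / 2 * w t.
  move=> gw hw ghD t.
  have [S0 Ssol [M SM]] := SH g gw; have [S0' Ssol' [M' SM']] := SH h hw.
  have fD : weight_le gm (fun x => f g x - f h x) (k ^+ 2 / 2 * D).
    move=> x x0; rewrite /f clampE//.
    apply: le_trans (Fl x _ _ x0 (wbE g gw x x0) (wbE h hw x x0)) _.
    have k2h : 0 <= k ^+ 2 / 2 by rewrite divr_ge0// ltW.
    by rewrite -(mulrA _ D) -wE//; exact: ler_wpM2l (ghD x).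
  have pD : weight_le gm (fun x => (S g).2 x - (S h).2 x) (M + M').
    move=> x x0; apply: le_trans (ler_normB _ _) _; rewrite mulrDl.
    by apply: lerD; [exact: SM|exact: SM'].
  have [_ H] := dichotomy_estimate k0 ak bk (dichotomy_solutionB Ssol Ssol') fD pD.
  apply: le_trans (H _ (clamp_ge0 t)) _.
  apply: ler_wpM2r; first exact: expR_ge0.
  rewrite S0 S0' subrr normr0 add0r.
  by apply: ler_of_eq; field.
have [g [gw gE]] := weighted_contraction w0 wc e0 PhiG PhiL.
have [S0 Ssol SM] := SH g gw.
have Sg (x : R) : 0 <= x -> (S g).1 x = g x.
  by move=> x0; rewrite -gE /Phi clampE.
exists (S g).1, (S g).2; split => //.
- have -> : (fun x : R => F (clamp x) ((S g).1 (clamp x))) = f g; last exact: Ssol.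
  by apply/funext => x; rewrite /f Sg// clamp_ge0.
- by move=> x x0; rewrite Sg//; exact: wbE.
Qed.

End DichotomyFixedPoint.

Section EulerSystem.
Variables (R : realType) (n : nat).
Local Notation V := 'cV[R]_n.

Lemma mulmx_bound m (A : 'M[R]_(m, n)) :
  exists2 K, 0 < K & forall v : V, `|A *m v| <= K * `|v|.
Proof.
exists (`|A| * n%:R + 1); first by rewrite ltr_wpDl// mulr_ge0.
move=> v; apply: mx_norm_leP => [|i j]; first by rewrite mulr_ge0// addr_ge0// mulr_ge0.
rewrite mxE mulrDl mul1r; apply: le_trans (ler_norm_sum _ _ _) _.
rewrite (_ : _ * _ * _ = \sum_(k < n) `|A| * `|v|); last first.
  by rewrite sumr_const card_ord mulrAC -[RHS]mulr_natr.
rewrite -[leLHS]addr0 lerD//; apply: ler_sum => k _.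
by rewrite normrM ler_pM// ler_mx_entry.
Qed.

Lemma mulmx_continuous m (A : 'M[R]_(m, n)) : continuous (fun v : V => A *m v).
Proof.
have [K K0 HK] := mulmx_bound A.
move=> v; apply/(@cvgrPdist_le _ _ _ (nbhs (v : V))) => e e0.
have eK : 0 < e / K by rewrite divr_gt0.
apply/nbhs_ballP; exists (e / K) => //= u; rewrite -ball_normE /= => /ltW uv.
rewrite -mulmxBr; apply: le_trans (HK _) _.
by rewrite mulrC -ler_pdivlMr.
Qed.

Lemma is_derive_mulmx (A : 'M[R]_n) (q : R -> V) (x : R) (l : V) :
  is_derive x 1 q l -> is_derive x 1 (fun t => A *m q t) (A *m l).
Proof.
move/is_derive_col => H; apply/is_derive_col => i.
have -> : (fun t => (A *m q t) i 0) = \sum_j (fun t => A i j * q t j 0).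
  by apply/funext => t; rewrite mxE fct_sumE.
rewrite mxE; apply: is_derive_sum => j; exact: is_deriveZ.
Qed.

Variables (B P : 'M[R]_n) (c : 'rV[R]_n) (cs gm : R).
Hypotheses (Pu : P \in unitmx) (BP : B *m P = P *m diag_mx c).
Hypotheses (cs4 : - (1 / 4) < cs) (ccs : forall i, cs <= c 0 i).
Hypotheses (gms : (1 - Num.sqrt (1 + 4 * cs)) / 2 < gm) (gm2 : gm < 1 / 2).

(** If c > -1/4 is an eigenvalue of B, the indicial roots of q'' - q' = c q are a and
    1 - a with a = (1 - sqrt (1 + 4 c)) / 2, and a is largest at the smallest
    eigenvalue. So a gm between that root and 1/2 separates all the a's from all the
    1 - a's, and the system decouples in the basis P of eigenvectors. The constants l
    and s only depend on B and gm: the nonlinearity can be chosen after them. *)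
Lemma euler_system : exists2 l, 0 < l & exists2 s, 0 < s &
  forall (F : R -> V -> V) (e : R) (phi0 : V), 0 <= e ->
  (forall g : R -> V, continuous g ->
     (forall x : R, 0 <= x -> `|g x| <= e * expR (gm * x)) ->
     continuous (fun x => F (clamp x) (g (clamp x)))) ->
  (forall (x : R) (u v : V), 0 <= x -> `|u| <= e * expR (gm * x) ->
     `|v| <= e * expR (gm * x) -> `|F x u - F x v| <= l * `|u - v|) ->
  (forall x : R, 0 <= x -> `|F x 0| <= s * e * expR (gm * x)) ->
  `|phi0| <= s * e ->
  exists phi chi : R -> V, [/\ phi 0 = phi0,
    forall x : R, -1 < x -> is_derive x 1 phi (chi x),
    forall x : R, -1 < x -> is_derive x 1 chi
      (chi x + B *m phi x + F (clamp x) (phi (clamp x))),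
    weight_le gm phi e & exists M, weight_le gm chi M].
Proof.
pose a i := (1 - Num.sqrt (1 + 4 * c 0 i)) / 2.
pose k := gm - (1 - Num.sqrt (1 + 4 * cs)) / 2.
have k0 : 0 < k by rewrite subr_gt0.
have sc i : Num.sqrt (1 + 4 * cs) <= Num.sqrt (1 + 4 * c 0 i).
  by rewrite ler_sqrt; have := ccs i; have := cs4; lra.
have ak i : k <= gm - a i by rewrite /k /a; have := sc i; lra.
have bk i : k <= 1 - a i - gm by rewrite /k /a; have := sc i; have := gm2; lra.
have ac i : a i ^+ 2 = a i + c 0 i.
  have h : 0 <= 1 + 4 * c 0 i by have := ccs i; have := cs4; lra.
  by have := sqr_sqrtr h; rewrite /a !expr2; nra.
have [p1 p10 Hp1] := mulmx_bound P.
have [p2 p20 Hp2] := mulmx_bound (invmx P).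
have p1N : p1 != 0 by rewrite gt_eqF.
have p2N : p2 != 0 by rewrite gt_eqF.
have k20 : 0 < k ^+ 2 by rewrite exprn_gt0.
exists (k ^+ 2 / (2 * p1 * p2)); first by rewrite divr_gt0// !mulr_gt0.
pose mk := Num.min 1 (k ^+ 2).
have mk0 : 0 < mk by rewrite /mk lt_min ltr01.
have mk1 : mk <= 1 by rewrite /mk ge_min lexx.
have mk2 : mk <= k ^+ 2 by rewrite /mk ge_min lexx orbT.
exists (mk / (4 * p1 * p2)); first by rewrite divr_gt0// !mulr_gt0.
move=> F e phi0 e0 Fc Fl F0 phi0e.
pose F' x q := invmx P *m F x (P *m q).
have Pe x (u : V) : `|u| <= e / p1 * expR (gm * x) -> `|P *m u| <= e * expR (gm * x).
  move=> ue; apply: le_trans (Hp1 _) _; rewrite mulrC -ler_pdivlMr//.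
  by rewrite mulrAC.
have [] := @dichotomy_fixed_point R n a gm k k0 ak bk F' (e / p1) (invmx P *m phi0).
- by rewrite divr_ge0// ltW.
- move=> g gc gw x.
  apply: (@continuous_comp _ _ _ (fun x => F (clamp x) (P *m g (clamp x)))
    (fun v => invmx P *m v)); last exact: mulmx_continuous.
  apply: (Fc (fun x => P *m g x)); last by move=> y y0; apply: Pe; exact: gw.
  move=> y; apply: (@continuous_comp _ _ _ g (fun v => P *m v)); first exact: gc.
  exact: mulmx_continuous.
- move=> x u v x0 ue ve; rewrite /F' -mulmxBr.
  apply: le_trans (Hp2 _) _.
  have := Fl x _ _ x0 (Pe x u ue) (Pe x v ve); rewrite -mulmxBr => H.
  have c0 : 0 <= k ^+ 2 / (2 * p1 * p2) by rewrite divr_ge0 ?ltW// !mulr_gt0.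
  have := le_trans H (ler_wpM2l c0 (Hp1 (u - v))) => {}H.
  apply: le_trans (ler_wpM2l (ltW p20) H) _.
  by apply: ler_of_eq; field; rewrite p1N p2N.
- move=> x x0; rewrite /F' mulmx0; apply: le_trans (Hp2 _) _.
  apply: le_trans (ler_wpM2l (ltW p20) (F0 x x0)) _.
  rewrite [leLHS]mulrA; apply: ler_wpM2r; first exact: expR_ge0.
  rewrite (_ : p2 * _ = mk * (e / p1 / 4)); last by field; rewrite p1N p2N.
  by apply: ler_wpM2r mk2; rewrite !divr_ge0// ltW.
- apply: le_trans (Hp2 _) _; apply: le_trans (ler_wpM2l (ltW p20) phi0e) _.
  rewrite (_ : p2 * _ = mk * (e / p1 / 4)); last by field; rewrite p1N p2N.
  by rewrite -[leRHS]mul1r; apply: ler_wpM2r mk1; rewrite !divr_ge0// ltW.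
move=> q [p [q0 sol qe [M pM]]].
pose chiq x := \col_i (a i * q x i 0 + p x i 0).
have dq (x : R) : -1 < x -> is_derive x 1 q (chiq x).
  by move=> x1; apply/is_derive_col => i; rewrite mxE; have [] := sol i x x1.
pose f x := F (clamp x) (P *m q (clamp x)).
have dchi (x : R) : -1 < x ->
    is_derive x 1 chiq (chiq x + diag_mx c *m q x + invmx P *m f x).
  move=> x1; apply/is_derive_col => i.
  have [d1 d2] := sol i x x1.
  have -> : (fun t => chiq t i 0) = (fun t => a i * q t i 0 + p t i 0).
    by apply/funext => t; rewrite mxE.
  rewrite mxE [(chiq x + _) i 0]mxE mul_diag_mx [chiq x i 0]mxE [(\matrix_(_, _) _) i 0]mxE.
  have -> : a i * q x i 0 + p x i 0 + c 0 i * q x i 0 + (invmx P *m f x) i 0 =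
     a i * (a i * q x i 0 + p x i 0) +
     ((1 - a i) * p x i 0 + (invmx P *m f x) i 0).
    have /(congr1 (fun z => z * q x i 0)) := ac i; rewrite expr2 mulrDl => E.
    by rewrite mulrDr mulrA E; ring.
  apply: is_deriveD => //; exact: is_deriveZ.
exists (fun x => P *m q x), (fun x => P *m chiq x); split.
- by rewrite q0 mulmxA mulmxV// mul1mx.
- by move=> x x1; exact: is_derive_mulmx (dq x x1).
- move=> x x1; have := is_derive_mulmx P (dchi x x1).
  by rewrite !mulmxDr !mulmxA -BP mulmxV// mul1mx.
- by move=> x x0; apply: Pe; exact: qe.
- have [A A0 HA] : exists2 A, 0 <= A & forall i, `|a i| <= A.
    exists (\sum_i `|a i|); first by apply: sumr_ge0.
    by move=> i; rewrite (bigD1 i)//= lerDl sumr_ge0.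
  exists (p1 * (A * (e / p1) + M)) => x x0.
  have M0 := weight_le_ge0 pM.
  apply: le_trans (Hp1 _) _; rewrite -mulrA ler_pM2l//.
  apply: weight_le_col x0; first by rewrite addr_ge0// mulr_ge0// divr_ge0// ltW.
  move=> i y y0; rewrite mxE; apply: le_trans (ler_normD _ _) _.
  rewrite mulrDl normrM -mulrA lerD//; last exact: weight_le_coord.
  by rewrite ler_pM//; exact: weight_le_coord.
Qed.

End EulerSystem.

(** * Diagonalization of matrices self-adjoint for the mass product *)

(** Puts the spectral theorem in the form expected by [real_similar]. *)
Lemma similar_conj (F : fieldType) n (A Q D : 'M[F]_n) : Q \in unitmx ->
  A = invmx Q *m D *m Q -> similar_in unitmx A D.
Proof.
by move=> Qu ->; exists Q => //; apply/(similarP Qu); rewrite !mulmxA mulmxV// mul1mx.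
Qed.

Section RealSymmetric.
Variables (R : rcfType) (n : nat).

(** Over the complex closure of R the spectral theorem diagonalizes S with real
    eigenvalues; two real matrices similar over the closure are similar over R. *)
Lemma real_symmetric_diagonalizable (S : 'M[R]_n) : S^T = S ->
  exists P (c : 'rV[R]_n), P \in unitmx /\ S *m P = P *m diag_mx c.
Proof.
move=> St; pose f := real_complex R; pose A := map_mx f S.
have Ar : A \is a mxOver Num.real.
  by apply/mxOverP => i j; rewrite mxE; apply/complex_realP; exists (S i j).
have As : A \is symmetricmx.
  by apply/is_hermitianmxP/matrixP => i j; rewrite expr0 scale1r !mxE /= -{1}St mxE.
have Ah := realsym_hermsym As Ar.
have [Q [d [Qu dr AE]]] : exists Q d, [/\ Q \in unitmx,
    d \is a mxOver Num.real & A = invmx Q *m diag_mx d *m Q].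
  exists (spectralmx A), (spectral_diag A); split.
  - exact: spectral_unit.
  - exact: hermitian_spectral_diag_real Ah.
  - by apply/orthomx_spectralP; exact: hermitian_normalmx.
have sim := similar_conj Qu AE.
have Dr : diag_mx d \is a mxOver Num.real.
  apply/mxOverP => i j; rewrite mxE; case: eqP => _; rewrite ?mulr1n ?mulr0n//.
  by move/mxOverP: dr; apply.
have [T] := real_similar sim Ar Dr.
rewrite inE => /andP[Tr Tu] /(similarP Tu) TA.
pose T' := map_mx (@complex.Re R) T; pose d' := map_mx (@complex.Re R) d.
have TE : T = map_mx f T'.
  apply/matrixP => i j; rewrite !mxE; apply/esym/RRe_real.
  by move/mxOverP: Tr; apply.
have dE : d = map_mx f d'.
  apply/matrixP => i j; rewrite !mxE; apply/esym/RRe_real.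
  by move/mxOverP: dr; apply.
have T'u : T' \in unitmx by rewrite TE map_unitmx in Tu.
have E : T' *m S = diag_mx d' *m T'.
  apply: (@map_mx_inj _ _ f).
  by rewrite !map_mxM map_diag_mx -dE -TE.
exists (invmx T'), d'; split; first by rewrite unitmx_inv.
by apply: (can_inj (mulKmx T'u)); rewrite !mulmxA E mulmxK// mulmxV// mul1mx.
Qed.

(** With D = mu^{-1/2}, the matrix mu^{-1} G equals D (D G D) D^{-1}, a conjugate of a
    symmetric matrix. *)
Lemma scaled_symmetric_diagonalizable (mu : 'I_n -> R) (G : 'M[R]_n) :
  (forall i, 0 < mu i) -> G^T = G ->
  exists P (c : 'rV[R]_n), P \in unitmx /\
    (\matrix_(i, j) ((mu i)^-1 * G i j)) *m P = P *m diag_mx c.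
Proof.
move=> mu0 Gt.
pose D := diag_mx (\row_i (Num.sqrt (mu i))^-1).
have DE : (\matrix_(i, j) ((mu i)^-1 * G i j)) = D *m (D *m G).
  apply/matrixP => i j; rewrite !mul_diag_mx !mxE mulrA -invfM.
  by rewrite -expr2 sqr_sqrtr// ltW.
have Dt : D^T = D by rewrite tr_diag_mx.
have Du : D \in unitmx.
  rewrite unitmxE det_diag unitfE; apply/prodf_neq0 => i _.
  by rewrite mxE invr_eq0 sqrtr_eq0 -ltNge.
have St : (D *m G *m D)^T = D *m G *m D by rewrite !trmx_mul Dt Gt mulmxA.
have [Q [c [Qu QE]]] := real_symmetric_diagonalizable St.
exists (D *m Q), c; split; first by rewrite unitmx_mul Du.
by rewrite DE -[in RHS]mulmxA -QE !mulmxA.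
Qed.

End RealSymmetric.

(** * The mass scalar product *)

Section MassProduct.
Variables (R : realType) (d : nat) (mu : 'I_d -> R).
Local Notation V := 'cV[R]_d.
Local Notation "<< x , y >>" := (mdot mu x y).
Local Notation "|[ x ]|" := (mnorm mu x).
Hypothesis mu0 : forall j, 0 < mu j.

Lemma mdotC x y : <<x, y>> = <<y, x>>.
Proof. by apply: eq_bigr => j _; rewrite mulrAC. Qed.

Lemma mdotDl x y z : <<x + y, z>> = <<x, z>> + <<y, z>>.
Proof.
by rewrite -big_split; apply: eq_bigr => j _; rewrite mxE mulrDr mulrDl.
Qed.

Lemma mdotZl k x y : <<k *: x, y>> = k * <<x, y>>.
Proof.
by rewrite /mdot mulr_sumr; apply: eq_bigr => j _; rewrite mxE; ring.
Qed.

Lemma mdotZr k x y : <<x, k *: y>> = k * <<x, y>>.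
Proof. by rewrite mdotC mdotZl mdotC. Qed.

Lemma mdotBl x y z : <<x - y, z>> = <<x, z>> - <<y, z>>.
Proof. by rewrite mdotDl -scaleN1r mdotZl mulN1r. Qed.

Lemma mdotBr x y z : <<x, y - z>> = <<x, y>> - <<x, z>>.
Proof. by rewrite mdotC mdotBl !(mdotC x). Qed.

Lemma mdot_ge0 x : 0 <= <<x, x>>.
Proof.
by apply: sumr_ge0 => j _; rewrite -mulrA mulr_ge0 ?(ltW (mu0 j))// -expr2 sqr_ge0.
Qed.

Lemma mnorm_ge0 x : 0 <= |[x]|.
Proof. exact: sqrtr_ge0. Qed.

Lemma mnorm_sqr x : |[x]| ^+ 2 = <<x, x>>.
Proof. by rewrite sqr_sqrtr// mdot_ge0. Qed.

Lemma mnormZ k x : |[k *: x]| = `|k| * |[x]|.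
Proof.
by rewrite /mnorm mdotZl mdotZr mulrA -expr2 sqrtrM ?sqr_ge0// sqrtr_sqr.
Qed.

Lemma mnorm_coord (x : V) j : `|x j 0| <= (Num.sqrt (mu j))^-1 * |[x]|.
Proof.
have s0 : 0 < Num.sqrt (mu j) by rewrite sqrtr_gt0.
rewrite mulrC ler_pdivlMr// mulrC.
rewrite -sqrtr_sqr -sqrtrM ?(ltW (mu0 j))//; apply: ler_wsqrtr.
rewrite /mdot (bigD1 j)//= -mulrA -expr2 lerDl; apply: sumr_ge0 => i _.
by rewrite -mulrA mulr_ge0 ?(ltW (mu0 i))// -expr2 sqr_ge0.
Qed.

Lemma norm_le_mnorm : exists2 K, 0 < K & forall x : V, `|x| <= K * |[x]|.
Proof.
have i0 j : 0 <= (Num.sqrt (mu j))^-1 by rewrite invr_ge0 sqrtr_ge0.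
have S0 : 0 <= \sum_j (Num.sqrt (mu j))^-1 by apply: sumr_ge0 => j _; exact: i0.
exists (\sum_j (Num.sqrt (mu j))^-1 + 1); first by rewrite ltr_wpDl.
move=> x; apply: mx_norm_leP => [|i j].
  by rewrite mulr_ge0 ?mnorm_ge0// addr_ge0.
rewrite (ord1 j); apply: le_trans (mnorm_coord x i) _.
apply: ler_wpM2r; first exact: mnorm_ge0.
rewrite (bigD1 i)//= -addrA lerDl addr_ge0//; apply: sumr_ge0 => k _; exact: i0.
Qed.

Lemma mnorm_le_norm : exists2 K, 0 < K & forall x : V, |[x]| <= K * `|x|.
Proof.
have m0 : 0 <= \sum_j mu j by apply: sumr_ge0 => j _; exact: ltW.
exists (Num.sqrt (\sum_j mu j) + 1); first by rewrite ltr_wpDl// sqrtr_ge0.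
move=> x; apply: (@le_trans _ _ (Num.sqrt (\sum_j mu j) * `|x|)); last first.
  by rewrite ler_wpM2r// lerDl.
rewrite /mnorm -[in leRHS](normr_id x) -[in leRHS]sqrtr_sqr -sqrtrM//.
apply: ler_wsqrtr; rewrite mulr_suml; apply: ler_sum => j _.
rewrite -mulrA ler_wpM2l ?(ltW (mu0 j))// -expr2 -real_normK ?num_real//.
by rewrite lerXn2r ?nnegrE// ler_mx_entry.
Qed.

Lemma continuous_scaled_coord (j : 'I_d) (k : R) :
  continuous (fun x : V => k * x j 0).
Proof.
move=> x; apply: (@continuousM _ _ (fun=> k) (fun x : V => x j 0)).
  exact: cst_continuous.
exact: coord_continuous.
Qed.

Lemma mdot_continuous (y : V) : continuous (fun x : V => <<x, y>>).
Proof.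
apply: continuous_big => [|j _]; first exact: add_continuous.
move=> x; apply: (@continuousM _ _ (fun x : V => mu j * x j 0) (fun=> y j 0)).
  exact: continuous_scaled_coord.
exact: cst_continuous.
Qed.

Lemma mdot_sqr_continuous : continuous (fun x : V => <<x, x>>).
Proof.
apply: continuous_big => [|j _]; first exact: add_continuous.
move=> x; apply: (@continuousM _ _ (fun x : V => mu j * x j 0) (fun x : V => x j 0)).
  exact: continuous_scaled_coord.
exact: coord_continuous.
Qed.

Lemma mnorm_continuous : continuous (mnorm mu).
Proof.
move=> x; apply: (@continuous_comp _ _ _ (fun x : V => <<x, x>>) Num.sqrt).
  exact: mdot_sqr_continuous.
exact: sqrt_continuous.
Qed.

End MassProduct.

(** * Homogeneous potentials and central configurations *)

Section Homogeneity.
Variables (R : realType) (V : normedModType R) (Sigma : set V).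
Hypothesis oS : open Sigma.

(** Differentiating g (l y) = c g y in y: a derivative of a homogeneous function of
    degree p is homogeneous of degree p - 1. *)
Lemma derive_scaled (g : V -> R) (x v : V) (l c : R) : Sigma x -> 0 < l ->
  (forall y, Sigma y -> g (l *: y) = c * g y) -> derivable g x v ->
  is_derive (l *: x) v g (c / l * 'D_v g x).
Proof.
move=> Sx l0 gl gd; have lN : l != 0 by rewrite gt_eqF.
rewrite -[l *: x]add0r -[X in X + _](scale0r v); apply: is_derive_lineP.
have d0 : is_derive (0 / l) 1 (fun t : R => g (t *: v + x)) ('D_v g x).
  rewrite mul0r; have := @is_derive_line _ _ _ g x v 0.
  by rewrite scale0r add0r; apply.
have dl : is_derive (0 : R) 1 (fun t : R => t / l) l^-1.
  rewrite (_ : (fun t : R => t / l) = l^-1 \*: id); last first.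
    by apply/funext => t; rewrite /= mulrC.
  by rewrite -[X in is_derive _ _ _ X]mulr1; exact: is_deriveZ.
have dc := @is_derive1_comp _ (fun t : R => g (t *: v + x)) (fun t : R => t / l) 0 _ _ d0 dl.
have := is_deriveZ c dc.
rewrite (_ : c *: _ = c / l * 'D_v g x); last by rewrite /GRing.scale /=; ring.
apply: near_eq_is_derive.
have Snear : \forall t \near (0 : R), Sigma ((t / l) *: v + x).
  have : (fun t : R => (t / l) *: v + x) t @[t --> (0 : R)] --> (0 / l) *: v + x.
    apply: cvgD; last exact: cvg_cst.
    apply: (@continuous_comp _ _ _ (fun t : R => t / l) (fun t : R => t *: v)).
      exact: mulrr_continuous.
    exact: scalel_continuous.
  by rewrite mul0r scale0r add0r; apply; exact: open_nbhs_nbhs.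
apply: filterS Snear => t St /=.
by rewrite /GRing.scale /= -gl// scalerDr scalerA mulrCA mulfV// mulr1.
Qed.

(** Along the ray through x the function is t |-> (1 + t)^p g x, whose derivative at 0
    is explicit. *)
Lemma derive_euler (g : V -> R) (x : V) (p : R) : Sigma x ->
  (forall y l, Sigma y -> 0 < l -> g (l *: y) = l `^ p * g y) ->
  is_derive x x g (p * g x).
Proof.
move=> Sx gl.
rewrite -[X in is_derive X]add0r -[X in is_derive (X + _)](scale0r x).
apply: is_derive_lineP.
have dp : is_derive ((0 : R) + 1 : R) 1 ((powR (R:=R))^~ p) (p * (0 + 1) `^ (p - 1)).
  by apply: is_derive1_powR; rewrite add0r.
have d1 : is_derive (0 : R) 1 (fun t : R => t + 1) (1 + 0) by exact: is_deriveD.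
have := is_deriveZ (g x) (@is_derive1_comp _ _ (fun t : R => t + 1) 0 _ _ dp d1).
rewrite (_ : g x *: _ = p * g x); last first.
  by rewrite add0r powR1 addr0 !mulr1 mulrC.
apply: near_eq_is_derive.
have : \forall t \near (0 : R), -1 < t by apply: lt_nbhsr; rewrite oppr_lt0.
apply: filterS => t t1 /=.
have -> : t *: x + x = (t + 1) *: x by rewrite scalerDl scale1r.
rewrite gl//; first exact: mulrC.
by rewrite -ltrBlDr sub0r.
Qed.

End Homogeneity.

Lemma Ck1_derive (R : realType) (d : nat) (A : set 'cV[R]_d) (g : 'cV[R]_d -> R)
  (x v : 'cV[R]_d) : open A -> Ck_on 1 A g -> A x ->
  is_derive x v g (\sum_j 'D_(basis_vec R j) g x * v j 0).
Proof.
move=> oA Cg Ax; apply: derive_partials.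
  have : \forall z \near x, A z by exact: open_nbhs_nbhs.
  by apply: filterS => z Az j; have [H _] := Ck_on_openS oA Cg (basis_vec R j); exact: H.
move=> j; have [_ H] := Ck_on_openS oA Cg (basis_vec R j).
exact: (Ck_on_open0 oA H).
Qed.

Section CentralConfiguration.
Variables (R : realType) (d : nat) (mu : 'I_d -> R).
Local Notation V := 'cV[R]_d.
Local Notation "<< x , y >>" := (mdot mu x y).
Local Notation e_ j := (@basis_vec R d j).
Variables (alpha : R) (Sigma : set V) (U : V -> R) (xi : V).
Hypotheses (mu0 : forall j, 0 < mu j) (oS : open Sigma)
  (UC2 : Ck_on 2 Sigma U)
  (Uhom : forall (x : V) (l : R), Sigma x -> 0 < l ->
     U (l *: x) = l `^ (- alpha) * U x)
  (cc : central_configuration mu Sigma U xi).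

(** The ambient Hessian M^{-1} D^2 U at xi, indexed so that it acts on columns as the
    derivative of the mass gradient, see [derive_grad]. *)
Definition hess_mx : 'M[R]_d :=
  \matrix_(i, j) ((mu i)^-1 * 'D_(e_ j) ('D_(e_ i) U) xi).

Let Sxi : Sigma xi. Proof. by case: cc. Qed.

Let UC1 : Ck_on 1 Sigma U. Proof. exact: Ck_on_le. Qed.

Lemma deriveU (x v : V) : Sigma x -> is_derive x v U <<mgrad mu U x, v>>.
Proof.
move=> Sx; rewrite (_ : <<_, _>> = \sum_j 'D_(e_ j) U x * v j 0).
  exact: Ck1_derive oS UC1 Sx.
by apply: eq_bigr => j _; rewrite mxE mulVKf ?gt_eqF.
Qed.

Lemma euler_identity (x : V) : Sigma x -> <<mgrad mu U x, x>> = - alpha * U x.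
Proof.
move=> Sx; have [_ <-] := deriveU x Sx.
by have [_ <-] := derive_euler Sx Uhom.
Qed.

(** At a critical point of the restriction, the gradient is normal; Euler's identity
    gives its normal component. *)
Lemma mgrad_xi : mgrad mu U xi = (- alpha * U xi) *: xi.
Proof.
case: cc => _ _ /eqP.
by rewrite /egrad /tproj euler_identity// subr_eq0 => /eqP.
Qed.

Lemma grad_homogeneous (x : V) (l : R) : Sigma x -> 0 < l ->
  mgrad mu U (l *: x) = l `^ (- alpha - 1) *: mgrad mu U x.
Proof.
move=> Sx l0; apply/matrixP => j k; rewrite !mxE.
have [Ud _] := Ck_on_openS oS UC1 (e_ j).
have [_ ->] := derive_scaled oS Sx l0 (fun y Sy => Uhom Sy l0) (Ud x Sx).
by rewrite powRD ?(gt_eqF l0) ?implybT// powR_inv1 ?ltW//; ring.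
Qed.

Lemma derive_partial (i : 'I_d) (x v : V) : Sigma x ->
  is_derive x v ('D_(e_ i) U) (\sum_j 'D_(e_ j) ('D_(e_ i) U) x * v j 0).
Proof.
move=> Sx; have [_ C1] := Ck_on_openS oS UC2 (e_ i).
exact: (Ck1_derive v oS C1 Sx).
Qed.

Lemma derive_grad (v : V) : is_derive xi v (mgrad mu U) (hess_mx *m v).
Proof.
apply/is_derive_col => i.
have -> : (fun t => mgrad mu U t i 0) = (mu i)^-1 \*: 'D_(e_ i) U.
  by apply/funext => t; rewrite mxE.
rewrite (_ : (hess_mx *m v) i 0 =
   (mu i)^-1 *: \sum_j 'D_(e_ j) ('D_(e_ i) U) xi * v j 0).
  by apply: is_deriveZ; exact: derive_partial.
by rewrite mxE /GRing.scale /= mulr_sumr; apply: eq_bigr => j _; rewrite mxE mulrA.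
Qed.

Lemma hess_sym i j : 'D_(e_ j) ('D_(e_ i) U) xi = 'D_(e_ i) ('D_(e_ j) U) xi.
Proof.
have Sn : \forall z \near xi, Sigma z by exact: open_nbhs_nbhs.
have D1 k : forall z, Sigma z -> derivable U z (e_ k).
  by have [] := Ck_on_openS oS UC1 (e_ k).
have C1 k : Ck_on 1 Sigma ('D_(e_ k) U).
  by have [] := Ck_on_openS oS UC2 (e_ k).
have D2 k l : (forall z, Sigma z -> derivable ('D_(e_ k) U) z (e_ l)) /\
    {for xi, continuous ('D_(e_ l) ('D_(e_ k) U))}.
  have [H C0] := Ck_on_openS oS (C1 k) (e_ l); split=> //.
  exact: (Ck_on_open0 oS C0).
apply: derive_comm; [|exact: (D2 i j).2|exact: (D2 j i).2].
apply: filterS Sn => z Sz; split.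
- exact: D1.
- exact: D1.
- exact: (D2 i j).1.
- exact: (D2 j i).1.
Qed.

Lemma hess_mx_sym (v w : V) : <<hess_mx *m v, w>> = <<v, hess_mx *m w>>.
Proof.
have E (a b : V) : <<hess_mx *m a, b>> =
    \sum_i \sum_j 'D_(e_ j) ('D_(e_ i) U) xi * a j 0 * b i 0.
  apply: eq_bigr => i _; rewrite mxE mulr_sumr mulr_suml; apply: eq_bigr => j _.
  by rewrite mxE !mulrA mulfV ?gt_eqF// mul1r.
rewrite E mdotC E exchange_big /=; apply: eq_bigr => j _; apply: eq_bigr => i _.
by rewrite hess_sym mulrAC.
Qed.

(** grad U is homogeneous of degree - alpha - 1 and equals - alpha U(xi) xi at xi:
    Euler's identity for its coordinates. *)
Lemma hess_mx_xi : hess_mx *m xi = ((alpha + 1) * alpha * U xi) *: xi.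
Proof.
apply/matrixP => i k; rewrite (ord1 k) {k} mxE.
rewrite (eq_bigr (fun j => (mu i)^-1 * ('D_(e_ j) ('D_(e_ i) U) xi * xi j 0))); last first.
  by move=> j _; rewrite mxE mulrA.
have hom y l : Sigma y -> 0 < l ->
    'D_(e_ i) U (l *: y) = l `^ (- alpha - 1) * 'D_(e_ i) U y.
  move=> Sy l0; have /matrixP/(_ i 0) := grad_homogeneous Sy l0.
  rewrite !mxE mulrCA => /(congr1 (fun z => mu i * z)).
  by rewrite !mulVKf ?gt_eqF.
rewrite -mulr_sumr; have [_ <-] := derive_partial i xi Sxi.
have [_ ->] := derive_euler Sxi hom.
have /matrixP/(_ i 0) := mgrad_xi; rewrite !mxE => E.
by rewrite mulrCA E; ring.
Qed.

(** Near xi the tangential gradient is grad U + alpha U(x) x by Euler's identity.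
    Differentiating along a tangent v, the variation of U vanishes, and what remains
    is tangent because H is self-adjoint and xi is an eigenvector of H. *)
Lemma ehess_tangent (v : V) : tangent_space mu xi v ->
  ehess mu U xi v = hess_mx *m v + (alpha * U xi) *: v.
Proof.
rewrite /tangent_space /= => vxi.
have gv : <<mgrad mu U xi, v>> = 0.
  by rewrite mgrad_xi mdotZl mdotC vxi mulr0.
have dU := deriveU v Sxi; rewrite gv in dU.
have dg := derive_grad v.
have dE : is_derive xi v (egrad mu U) (hess_mx *m v + (alpha * U xi) *: v).
  suff : is_derive xi v (fun x => mgrad mu U x + alpha *: (U x *: x))
      (hess_mx *m v + (alpha * U xi) *: v).
    apply: near_eq_is_derive.
    have : \forall z \near xi, Sigma z by exact: open_nbhs_nbhs.
    apply: filterS => z Sz.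
    by rewrite /egrad /tproj euler_identity// mulNr scaleNr opprK scalerA.
  apply: is_deriveD; rewrite -scalerA; apply: is_deriveZ.
  apply/is_derive_col => i.
  have -> : (fun x : V => (U x *: x) i 0) = (fun x : V => U x * x i 0).
    by apply/funext => x; rewrite mxE.
  have dx : is_derive xi v (fun x : V => x i 0) (v i 0).
    by have /is_derive_col := is_derive_id xi v; apply.
  have := is_deriveM dU dx; rewrite scaler0 addr0.
  by rewrite mxE.
rewrite /ehess; have [_ ->] := dE; rewrite /tproj mdotDl mdotZl hess_mx_sym hess_mx_xi.
by rewrite mdotZr vxi !mulr0 addr0 scale0r subr0.
Qed.

(** H is self-adjoint and has xi as eigenvector, so any other eigenvector for a
    different eigenvalue is orthogonal to xi, that is tangent, and [ehess_tangent]
    applies. *)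
Lemma hess_mx_eigenvalue (nu1 c : R) (v : V) :
  smallest_ehess_eigenvalue mu U xi nu1 -> v != 0 -> hess_mx *m v = c *: v ->
  c = (alpha + 1) * alpha * U xi \/ nu1 - alpha * U xi <= c.
Proof.
move=> [_ nulb] v0 Hv; set K := (alpha + 1) * alpha * U xi.
have cK : (c - K) * <<v, xi>> = 0.
  have := hess_mx_sym v xi; rewrite Hv hess_mx_xi mdotZl mdotZr => E.
  by rewrite mulrBl E subrr.
have [m0|mN] := eqVneq <<v, xi>> 0; last first.
  by left; move/eqP: cK; rewrite mulf_eq0 (negPf mN) orbF subr_eq0 => /eqP.
right; rewrite lerBlDr; apply: nulb; exists v; split => //.
by rewrite ehess_tangent// Hv scalerDl.
Qed.

Lemma hess_mx_diagonalizable (nu1 : R) :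
  smallest_ehess_eigenvalue mu U xi nu1 ->
  exists P (c : 'rV[R]_d), [/\ P \in unitmx, hess_mx *m P = P *m diag_mx c &
    forall i, c 0 i = (alpha + 1) * alpha * U xi \/ nu1 - alpha * U xi <= c 0 i].
Proof.
move=> hnu.
pose G : 'M[R]_d := \matrix_(i, j) 'D_(e_ j) ('D_(e_ i) U) xi.
have Gt : G^T = G by apply/matrixP => i j; rewrite !mxE hess_sym.
have [P [c [Pu PE]]] := scaled_symmetric_diagonalizable mu0 Gt.
have HE : hess_mx = \matrix_(i, j) ((mu i)^-1 * G i j).
  by apply/matrixP => i j; rewrite !mxE.
exists P, c; split => //; first by rewrite HE.
move=> i; apply: (@hess_mx_eigenvalue _ _ (P *m e_ i)) => //.
  apply/eqP => /(congr1 (fun z => invmx P *m z)).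
  rewrite mulKmx// mulmx0 => /matrixP/(_ i 0)/eqP.
  by rewrite !mxE !eqxx oner_eq0.
rewrite mulmxA HE PE -mulmxA scalemxAr; congr (_ *m _).
apply/matrixP => j k; rewrite mul_diag_mx !mxE.
by have [->|_] := eqVneq j i; rewrite ?mulr0.
Qed.

End CentralConfiguration.

(** * Space derivatives of the perturbation *)

Section Slices.
Variables (R : realType).

Lemma within_comp (T V W : topologicalType) (A : set V) (f : V -> W) (g : T -> V) :
  {within A, continuous f} -> continuous g -> (forall t, A (g t)) ->
  continuous (fun t => f (g t)).
Proof.
move=> /subspace_continuousP fA gc gA t.
apply: cvg_trans (fA _ (gA t)) => P /= fP.
have : nbhs t (g @^-1` [set x | A x -> P (f x)]) by apply: gc; exact: fP.
by apply: filterS => s; apply; exact: gA.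
Qed.

Variables (V W : normedModType R) (H : set R) (T : set V) (f : R * V -> W).
Hypothesis oT : open T.

(** A purely spatial increment (0, v) keeps the time in H, so the constraint it
    meets is only membership in the open set T: the relative derivative is an
    ordinary space derivative, also at the boundary times. *)
Lemma derive_within_slice (t : R) (x v : V) : H t -> T x ->
  (derivable_within (H `*` T) f (t, x) (0, v) = derivable (fun y => f (t, y)) x v) *
  (derive_within (H `*` T) f (t, x) (0, v) = 'D_v (fun y => f (t, y)) x).
Proof.
move=> Ht Tx.
have sE (h : R) : h *: ((0 : R), v) + (t, x) = (t, h *: v + x).
  by congr (_, _); rewrite /= scaler0 add0r.
have E : within [set h : R | (H `*` T) (h *: ((0 : R), v) + (t, x))] 0^' = 0^'.
  apply: within_filterE.
  have : \forall h \near (0 : R)^', T (h *: v + x).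
    by apply: line_near; exact: open_nbhs_nbhs.
  apply: filterS => h Th.
    by change ((H `*` T) (h *: ((0 : R), v) + (t, x))); rewrite sE.
have qE : diff_quotient f (t, x) (0, v) =
    (fun h => h^-1 *: (f (t, h *: v + x) - f (t, x))).
  by apply/funext => h; rewrite /diff_quotient sE.
by rewrite /derivable_within /derive_within E qE.
Qed.

Lemma Ck_on_slice k : Ck_on k.+1 (H `*` T) f -> forall v : V,
  (forall t x, H t -> T x -> derivable (fun y => f (t, y)) x v) /\
  Ck_on k (H `*` T) (fun p => 'D_v (fun y => f (p.1, y)) p.2).
Proof.
move=> [_ fk] v; have [d1 d2] := fk (0, v); split.
  by move=> t x Ht Tx; have := d1 (t, x) (conj Ht Tx); rewrite derive_within_slice.
by apply: Ck_on_ext d2 => -[t x] [/= Ht Tx]; rewrite derive_within_slice.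
Qed.

End Slices.

(** * Truncated cones around the central configuration *)

Section Cone.
Variables (R : realType) (d : nat) (mu : 'I_d -> R) (xi : 'cV[R]_d).
Local Notation V := 'cV[R]_d.
Local Notation "<< x , y >>" := (mdot mu x y).
Local Notation "|[ x ]|" := (mnorm mu x).
Hypotheses (mu0 : forall j, 0 < mu j) (xi1 : |[xi]| = 1).

Lemma cone_regionE (r eta : R) (x : V) : 0 < r ->
  cone_region mu xi r eta x <-> r < |[x]| /\ eta * |[x]| < <<x, xi>>.
Proof.
move=> r0; rewrite /cone_region /=; split=> -[rx h]; split=> //.
  by move: h; rewrite mdotZl mulrC ltr_pdivlMr// (lt_trans r0).
by rewrite mdotZl mulrC ltr_pdivlMr// (lt_trans r0).
Qed.

Lemma open_cone_region (r eta : R) : 0 < r -> open (cone_region mu xi r eta).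
Proof.
move=> r0.
have -> : cone_region mu xi r eta =
    (fun x => |[x]|) @^-1` [set y | r < y] `&`
    (fun x => <<x, xi>> - eta * |[x]|) @^-1` [set y | 0 < y].
  by apply/seteqP; split => x; rewrite cone_regionE//= subr_gt0.
apply: openI; apply: open_comp; try exact: open_gt.
  by move=> x _; exact: mnorm_continuous.
move=> x _; apply: (@continuousB _ _ _ (fun x => <<x, xi>>) (fun x => eta * |[x]|)).
  exact: mdot_continuous.
apply: (@continuousM _ _ (fun=> eta) (mnorm mu)); first exact: cst_continuous.
exact: mnorm_continuous.
Qed.

Lemma mdot_xi1 : <<xi, xi>> = 1.
Proof. by rewrite -mnorm_sqr// xi1 expr1n. Qed.

(** The three conditions are open and hold at xi; the last two carry over to
    dilations of xi + z, see [dilate_cone]. *)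
Lemma near_xi (Sigma : set V) (eta : R) : open Sigma -> Sigma xi -> eta < 1 ->
  exists2 rho, 0 < rho & forall z : V, `|z| < rho ->
    [/\ Sigma (xi + z), 1 / 2 < |[xi + z]| & eta * |[xi + z]| < <<xi + z, xi>>].
Proof.
move=> oS Sxi eta1.
have n1 : \forall y \near xi, Sigma y by exact: open_nbhs_nbhs.
have n2 : \forall y \near xi, 1 / 2 < |[y]|.
  have h : 0 < (1 / 4 : R) by rewrite divr_gt0.
  have := @continuous_near_le _ _ R (mnorm mu) xi _ (@mnorm_continuous _ _ mu xi) h.
  by apply: filterS => y; rewrite xi1 ler_norml => /andP[]; lra.
have n3 : \forall y \near xi, eta * |[y]| < <<y, xi>>.
  have c : {for xi, continuous (fun y => <<y, xi>> - eta * |[y]|)}.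
    apply: (@continuousB _ _ _ (fun x => <<x, xi>>) (fun x => eta * |[x]|)).
      exact: mdot_continuous.
    apply: (@continuousM _ _ (fun=> eta) (mnorm mu)); first exact: cst_continuous.
    exact: mnorm_continuous.
  have h : 0 < (1 - eta) / 2 by rewrite divr_gt0// subr_gt0.
  have := @continuous_near_le _ _ R _ xi _ c h.
  by apply: filterS => y; rewrite xi1 mdot_xi1 ler_norml => /andP[]; lra.
have : \forall y \near xi,
    [/\ Sigma y, 1 / 2 < |[y]| & eta * |[y]| < <<y, xi>>].
  by apply: filterS3 n1 n2 n3 => y h1 h2 h3; split.
move=> /nbhs_ballP[rho /= rho0 H].
exists rho => // z zr; apply: H.
by rewrite -ball_normE /= opprD addrA subrr sub0r normrN.
Qed.

Lemma dilate_cone (r eta s : R) (y : V) : 0 < r -> 2 * r <= s -> 1 / 2 < |[y]| ->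
  eta * |[y]| < <<y, xi>> -> cone_region mu xi r eta (s *: y).
Proof.
move=> r0 rs y2 ye; have s0 : 0 < s by lra.
rewrite cone_regionE// mnormZ gtr0_norm// mdotZl; split; first by nra.
by rewrite mulrCA ltr_pM2l.
Qed.

(** For unit vectors |y - xi|^2 = 2 - 2 <y, xi>. *)
Lemma cone_direction (rho : R) : 0 < rho ->
  exists2 eta, eta < 1 & forall x, 0 < |[x]| -> eta < <<|[x]|^-1 *: x, xi>> ->
    `||[x]|^-1 *: x - xi| < rho.
Proof.
move=> rho0; have [K K0 HK] := norm_le_mnorm mu0.
exists (1 - (rho / K) ^+ 2 / 2).
  by rewrite ltrBlDr ltrDl divr_gt0// exprn_gt0// divr_gt0.
move=> x x0; set y := _ *: x => ye.
have y1 : |[y]| = 1 by rewrite mnormZ ger0_norm ?invr_ge0 ?mnorm_ge0// mulVf// gt_eqF.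
have yy : <<y, y>> = 1 by rewrite -mnorm_sqr// y1 expr1n.
apply: le_lt_trans (HK _) _; rewrite mulrC -ltr_pdivlMr//.
rewrite -(@ltr_pXn2r _ 2)// ?nnegrE ?mnorm_ge0 ?divr_ge0 ?ltW//.
rewrite mnorm_sqr// mdotBl !mdotBr yy mdot_xi1 (mdotC mu xi y).
by move: ye; lra.
Qed.

End Cone.

(** * Size and Lipschitz constant of the forces *)

Section Estimates.
Variables (R : realType) (d : nat) (mu : 'I_d -> R).
Local Notation V := 'cV[R]_d.
Local Notation "|[ x ]|" := (mnorm mu x).
Local Notation e_ j := (@basis_vec R d j).
Hypothesis mu0 : forall j, 0 < mu j.

(** The set whose supremum is the operator norm is bounded, by equivalence of norms. *)
Lemma mopnorm_ge (A : 'M[R]_d) (x : V) : |[x]| <= 1 -> |[A *m x]| <= mopnorm mu A.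
Proof.
move=> x1; apply: ub_le_sup; last by exists x.
have [K K0 HK] := norm_le_mnorm mu0.
have [L L0 HL] := mnorm_le_norm mu0.
have [B B0 HB] := mulmx_bound A.
exists (L * (B * K)) => _ [y /= y1 <-].
apply: le_trans (HL _) _; rewrite ler_pM2l//.
apply: le_trans (HB _) _; rewrite ler_pM2l//.
by apply: le_trans (HK _) _; rewrite -[leRHS]mulr1 ler_pM2l.
Qed.

Lemma mopnorm_entry : exists2 K, 0 < K & forall (A : 'M[R]_d) i j,
  `|A i j| <= K * mopnorm mu A.
Proof.
have [K K0 HK] := norm_le_mnorm mu0.
have [L L0 HL] := mnorm_le_norm mu0.
exists (K * L); first exact: mulr_gt0.
move=> A i j.
have ej : `|e_ j| <= 1.
  by apply: mx_norm_leP => // k l; rewrite (ord1 l) basis_vecE; case: eqP => _; rewrite ?normr1 ?normr0.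
have e1 : |[L^-1 *: e_ j]| <= 1.
  rewrite mnormZ gtr0_norm ?invr_gt0// ler_pdivrMl// mulr1.
  by apply: le_trans (HL _) _; rewrite -[leRHS]mulr1 ler_pM2l.
have := mopnorm_ge A e1; rewrite -scalemxAr mnormZ gtr0_norm ?invr_gt0//.
rewrite ler_pdivrMl// => H.
have -> : A i j = (A *m e_ j) i 0.
  rewrite mxE (bigD1 j)//= basis_vecE eqxx mulr1 big1 ?addr0// => k kj.
  by rewrite basis_vecE (negPf kj) mulr0.
apply: le_trans (ler_mx_entry _ _ _) _; apply: le_trans (HK _) _.
by rewrite -mulrA ler_pM2l.
Qed.

(** Turns the hypothesis on W, in the mass and operator norms, into bounds on the
    coordinates in which mean value inequalities are available. *)
Lemma decay_bounds (xi : V) (r eta beta : R) (W : R -> V -> R) : 0 < r ->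
  uniform_decay mu (cone_region mu xi r eta) W beta ->
  exists C K : R, [/\ 0 < C, 0 < K & forall (t : R) (x : V), 0 <= t ->
    cone_region mu xi r eta x -> K < |[x]| ->
    `|mgrad mu (W t) x| <= C * |[x]| `^ (- beta - 1) /\
    forall i j, `|'D_(e_ j) ('D_(e_ i) (W t)) x| <= C * |[x]| `^ (- beta - 2)].
Proof.
move=> r0 [C [K HCK]].
have [A A0 HA] := norm_le_mnorm mu0.
have [B B0 HB] := mopnorm_entry.
pose M := \sum_i mu i.
have M0 : 0 <= M by apply: sumr_ge0 => i _; exact: ltW.
have muM i : mu i <= M.
  by rewrite /M (bigD1 i)//= lerDl; apply: sumr_ge0 => j _; exact: ltW.
exists ((`|C| + 1) * (A + M * B)), (`|K| + 1).
have C0 : 0 < `|C| + 1 by rewrite ltr_wpDl.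
have MB0 : 0 <= M * B by rewrite mulr_ge0// ltW.
have AB0 : 0 < A + M * B by rewrite ltr_wpDr.
split; [exact: mulr_gt0|by rewrite ltr_wpDl|].
move=> t x t0 cx Kx.
have K'x : K < |[x]|.
  by apply: le_lt_trans Kx; apply: le_trans (ler_norm K) _; rewrite lerDl.
have x0 : 0 < |[x]| by apply: le_lt_trans Kx; rewrite addr_ge0.
have xN : |[x]| != 0 by rewrite gt_eqF.
have := HCK t x t0 cx K'x.
set g := |[mgrad mu (W t) x]|; set h := mopnorm mu _ => H.
have g0 : 0 <= g by exact: mnorm_ge0.
have h0 : 0 <= h.
  apply: le_trans (mopnorm_ge (mhess mu (W t) x) (_ : |[0]| <= 1)).
    exact: mnorm_ge0.
  have := mnormZ mu 0 (0 : V); rewrite scale0r normr0 mul0r => ->; exact: ler01.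
have {}H : |[x]| * g + |[x]| ^+ 2 * h <= (`|C| + 1) * |[x]| `^ (- beta).
  apply: le_trans (_ : C * |[x]| `^ (- beta) <= _).
    by apply: le_trans H; rewrite -addrA lerDr.
  apply: ler_wpM2r; first exact: powR_ge0.
  by apply: le_trans (ler_norm C) _; rewrite lerDl.
have p1 : |[x]| `^ (- beta - 1) * |[x]| = |[x]| `^ (- beta).
  by rewrite -{2}(powRr1 (ltW x0)) -powRD ?subrK// (negPf xN) implybT.
have p2 : |[x]| `^ (- beta - 2) * |[x]| ^+ 2 = |[x]| `^ (- beta).
  by rewrite -(powR_mulrn _ (ltW x0)) -powRD ?subrK// (negPf xN) implybT.
have x20 : 0 < |[x]| ^+ 2 by rewrite exprn_gt0.
have hg : g <= (`|C| + 1) * |[x]| `^ (- beta - 1).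
  rewrite -(ler_pM2r x0) -mulrA p1; apply: le_trans H.
  by rewrite mulrC lerDl mulr_ge0// ltW.
have hh : h <= (`|C| + 1) * |[x]| `^ (- beta - 2).
  rewrite -(ler_pM2r x20) -mulrA p2; apply: le_trans H.
  by rewrite mulrC lerDr mulr_ge0// ltW.
split.
  apply: le_trans (HA _) _; apply: le_trans (ler_wpM2l (ltW A0) hg) _.
  rewrite mulrA [A * _]mulrC; apply: ler_wpM2r; first exact: powR_ge0.
  by rewrite ler_pM2l// lerDl.
move=> i j.
have -> : 'D_(e_ j) ('D_(e_ i) (W t)) x = mu j * mhess mu (W t) x j i.
  by rewrite mxE mulVKf// gt_eqF.
rewrite normrM (gtr0_norm (mu0 j)).
apply: le_trans (ler_pM (ltW (mu0 j)) (normr_ge0 _) (muM j) (HB _ _ _)) _.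
rewrite mulrA; apply: le_trans (ler_wpM2l MB0 hh) _.
rewrite mulrA [M * B * _]mulrC; apply: ler_wpM2r; first exact: powR_ge0.
by rewrite ler_pM2l// lerDr ltW.
Qed.

End Estimates.

Lemma continuous_col (R : realType) (n : nat) (T : topologicalType)
  (q : T -> 'cV[R]_n) (t : T) :
  (forall i, {for t, continuous (fun s => q s i 0)}) -> {for t, continuous q}.
Proof.
move=> H; apply/(@cvgrPdist_le _ _ _ (nbhs (t : T))) => e e0.
have : \forall s \near t, forall i, `|q s i 0 - q t i 0| <= e.
  apply: (@filter_forall _ _ (fun i s => `|q s i 0 - q t i 0| <= e) (nbhs t)) => i.
  exact: (@continuous_near_le _ _ R (fun s => q s i 0) t _ (H i) e0).
apply: filterS => s Hs; rewrite distrC; apply: mx_norm_leP => [|i k]; first exact: ltW.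
by have := Hs i; rewrite (ord1 k) !mxE.
Qed.

Section Nonlinearity.
Variables (R : realType) (d : nat) (mu : 'I_d -> R).
Local Notation V := 'cV[R]_d.
Local Notation e_ j := (@basis_vec R d j).
Hypothesis mu0 : forall j, 0 < mu j.

Lemma powR_antitone (a b p : R) : 0 < a -> a <= b -> p <= 0 -> b `^ p <= a `^ p.
Proof.
move=> a0 ab p0; have b0 := lt_le_trans a0 ab.
rewrite -[p]opprK !(powRN _ (- p)) lef_pV2 ?posrE ?powR_gt0//.
have p0' : 0 <= - p by rewrite oppr_ge0.
by apply: (ge0_ler_powR p0' _ _ ab); rewrite nnegrE ltW.
Qed.

Lemma derive_mgrad_coord (f : V -> R) (x : V) i j :
  derivable ('D_(e_ i) f) x (e_ j) ->
  is_derive x (e_ j) (fun y => mgrad mu f y i 0)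
    ((mu i)^-1 * 'D_(e_ j) ('D_(e_ i) f) x).
Proof.
move=> fd; have -> : (fun y => mgrad mu f y i 0) = (mu i)^-1 \*: 'D_(e_ i) f.
  by apply/funext => y; rewrite mxE.
by apply: is_deriveZ.
Qed.

(** [box_mvt_norm] for each coordinate. It serves with A the Hessian at xi for U, and
    with A = 0 for W, whose second derivatives are merely small. *)
Lemma field_lipschitz (g : V -> V) (A : 'M[R]_d) (c : V) (rho m : R) : 0 <= m ->
  (forall z, `|z - c| < rho -> forall i j,
     derivable (fun y => g y i 0) z (e_ j) /\
     `|'D_(e_ j) (fun y => g y i 0) z - A i j| <= m) ->
  forall x y, `|x - c| < rho -> `|y - c| < rho ->
  `|g y - g x - A *m (y - x)| <= m * d%:R * `|y - x|.
Proof.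
move=> m0 H x y xc yc; apply: mx_norm_leP => [|i k]; first by rewrite !mulr_ge0.
rewrite (ord1 k) {k}.
have := @box_mvt_norm R d (fun y => g y i 0) c rho m (A i)
  (fun z zc j => H z zc i j) x y xc yc.
rewrite (_ : (g y - g x - A *m (y - x)) i 0 =
   g y i 0 - g x i 0 - \sum_j A i j * (y j 0 - x j 0))//.
by rewrite !mxE; congr (_ - _); apply: eq_bigr => j _; rewrite !mxE.
Qed.

Variables (Sigma : set V) (U : V -> R) (xi : V).
Hypotheses (oS : open Sigma) (Sxi : Sigma xi) (UC2 : Ck_on 2 Sigma U).

Lemma mgrad_continuous (x : V) : Sigma x -> {for x, continuous (mgrad mu U)}.
Proof.
move=> Sx; apply: continuous_col => i.
have -> : (fun y => mgrad mu U y i 0) = (fun y => (mu i)^-1 * 'D_(e_ i) U y).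
  by apply/funext => y; rewrite mxE.
have [_ C1] := Ck_on_openS oS UC2 (e_ i).
apply: (@continuousM _ _ (fun=> (mu i)^-1) ('D_(e_ i) U)).
  exact: cst_continuous.
exact: (Ck_on_open0 oS C1).
Qed.

(** The partial derivatives of grad U are continuous at xi, hence within any given m
    of those of the linear part in a small ball. *)
Lemma grad_remainder (delta : R) : 0 < delta ->
  exists2 rho, 0 < rho & forall z z' : V, `|z| < rho -> `|z'| < rho ->
  `|mgrad mu U (xi + z) - mgrad mu U (xi + z')
     - hess_mx mu U xi *m (z - z')| <= delta * `|z - z'|.
Proof.
move=> d0; pose m := delta / (d%:R + 1).
have d1 : 0 < d%:R + 1 :> R by rewrite ltr_wpDl.
have m0 : 0 < m by rewrite divr_gt0.
have D2 i j : forall z, Sigma z -> derivable ('D_(e_ i) U) z (e_ j).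
  have [_ C1] := Ck_on_openS oS UC2 (e_ i).
  by have [] := Ck_on_openS oS C1 (e_ j).
have C2 i j : {for xi, continuous ('D_(e_ j) ('D_(e_ i) U))}.
  have [_ C1] := Ck_on_openS oS UC2 (e_ i).
  have [_ C0] := Ck_on_openS oS C1 (e_ j).
  exact: (Ck_on_open0 oS C0).
have N2 : \forall z \near xi, forall ij : 'I_d * 'I_d,
   `|(mu ij.1)^-1 * 'D_(e_ ij.2) ('D_(e_ ij.1) U) z - hess_mx mu U xi ij.1 ij.2| <= m.
  apply: (@filter_forall _ _ (fun (ij : 'I_d * 'I_d) z =>
   `|(mu ij.1)^-1 * 'D_(e_ ij.2) ('D_(e_ ij.1) U) z
     - hess_mx mu U xi ij.1 ij.2| <= m) (nbhs xi)) => -[i j] /=.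
  have mm : 0 < mu i * m by rewrite mulr_gt0.
  have := continuous_near_le (C2 i j) mm; apply: filterS => z.
  by rewrite mxE -mulrBr normrM gtr0_norm ?invr_gt0// ler_pdivrMl.
have N1 : \forall z \near xi, Sigma z by exact: open_nbhs_nbhs.
have : \forall z \near xi, Sigma z /\ forall ij : 'I_d * 'I_d,
   `|(mu ij.1)^-1 * 'D_(e_ ij.2) ('D_(e_ ij.1) U) z - hess_mx mu U xi ij.1 ij.2| <= m.
  by apply: filterS2 N1 N2 => z; split.
move=> /nbhs_ballP[rho /= rho0 B].
exists rho => // z z' zr zr'.
have E (a b : V) : a - b = (xi + a) - (xi + b) by rewrite opprD addrACA subrr add0r.
rewrite (E z z'); apply: le_trans (@field_lipschitz (mgrad mu U) (hess_mx mu U xi)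
  xi rho m (ltW m0) _ _ _ _ _) _.
- move=> y yx i j.
  have [|Sy Hy] := B y _; first by rewrite -ball_normE /= distrC.
  have [h1 h2] := derive_mgrad_coord (D2 i j y Sy).
  by split => //; rewrite h2; exact: (Hy (i, j)).
- by rewrite addrC addKr.
- by rewrite addrC addKr.
- apply: ler_wpM2r => //; rewrite /m mulrAC ler_pdivrMr//.
  by rewrite ler_pM2l// lerDl.
Qed.

End Nonlinearity.

Section Force.
Variables (R : realType) (d : nat) (mu : 'I_d -> R).
Local Notation V := 'cV[R]_d.
Local Notation "<< x , y >>" := (mdot mu x y).
Local Notation "|[ x ]|" := (mnorm mu x).
Local Notation e_ j := (@basis_vec R d j).
Variables (alpha beta r eta : R) (Sigma : set V) (U : V -> R) (xi : V) (W : R -> V -> R).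
Hypotheses (mu0 : forall j, 0 < mu j) (oS : open Sigma) (Sxi : Sigma xi)
  (xi1 : |[xi]| = 1) (UC2 : Ck_on 2 Sigma U) (r0 : 0 < r) (eta1 : eta < 1)
  (WC2 : Ck_on 2 (half_line R `*` cone_region mu xi r eta)
            (fun p : R * V => W p.1 p.2))
  (Wd : uniform_decay mu (cone_region mu xi r eta) W beta)
  (alpha0 : 0 < alpha) (ab : alpha < beta).
Local Notation T := (cone_region mu xi r eta).

Lemma powR_small (p e : R) : p < 0 -> 0 < e ->
  exists2 S, 0 < S & forall s, S <= s -> s `^ p <= e.
Proof.
move=> p0 e0; exists (e `^ p^-1); first exact: powR_gt0.
move=> s Ss; apply: le_trans (powR_antitone (powR_gt0 _ e0) Ss (ltW p0)) _.
by rewrite -powRrM mulVf ?lt_eqF// powRr1// ltW.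
Qed.

Lemma W_derivable (t : R) (x : V) i j : 0 <= t -> T x ->
  derivable ('D_(e_ i) (W t)) x (e_ j).
Proof.
move=> t0 Tx.
have oT := @open_cone_region R d mu xi r eta r0.
have Ht : half_line R t by rewrite /half_line /= in_itv /= andbT.
have [_ C1] := Ck_on_slice oT WC2 (e_ i).
by have [D1 _] := Ck_on_slice oT C1 (e_ j); exact: D1.
Qed.

Lemma W_grad_continuous : {within half_line R `*` T,
  continuous (fun p : R * V => mgrad mu (W p.1) p.2)}.
Proof.
have oT := @open_cone_region R d mu xi r eta r0.
apply/subspace_continuousP => p Ap.
have H i : (fun p : R * V => mgrad mu (W p.1) p.2 i 0) @ within (half_line R `*` T) (nbhs p)
    --> mgrad mu (W p.1) p.2 i 0.
  have -> : (fun p : R * V => mgrad mu (W p.1) p.2 i 0) =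
    (fun p : R * V => (mu i)^-1 * 'D_(e_ i) (W p.1) p.2).
    by apply/funext => q; rewrite mxE.
  have [_ [/subspace_continuousP C1 _]] := Ck_on_slice oT WC2 (e_ i).
  rewrite mxE; apply: cvgM; [exact: cvg_cst|exact: C1].
apply/cvgrPdist_le => e e0.
have : \forall q \near within (half_line R `*` T) (nbhs p),
    forall i, `|mgrad mu (W q.1) q.2 i 0 - mgrad mu (W p.1) p.2 i 0| <= e.
  apply: (@filter_forall _ _ (fun i q => `|mgrad mu (W q.1) q.2 i 0 -
    mgrad mu (W p.1) p.2 i 0| <= e) (within (half_line R `*` T) (nbhs p))) => i.
  by have /cvgrPdist_le/(_ e e0) := H i; apply: filterS => q; rewrite distrC.
apply: filterS => q Hq; rewrite distrC; apply: mx_norm_leP => [|i k]; first exact: ltW.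
by have := Hq i; rewrite (ord1 k) !mxE.
Qed.

(** The force at the position s (xi + z) and time t, multiplied by s^{alpha + 1} to
    undo the homogeneity of grad U, minus the constant and linear parts in z of the
    term coming from U. *)
Definition rescaled_force (s t : R) (z : V) : V :=
  (mgrad mu U (xi + z) - mgrad mu U xi - hess_mx mu U xi *m z)
  + s `^ (alpha + 1) *: mgrad mu (W t) (s *: (xi + z)).

(** On the ball of radius s rho around s xi the second derivatives of W are
    O(s^{- beta - 2}), so after rescaling the force of W has Lipschitz constant
    O(s^{alpha - beta}), small for s large. The part coming from U vanishes at z = 0,
    where only the force of W, O(s^{alpha - beta}), remains. *)
Lemma force_contraction (delta : R) : 0 < delta ->
  exists rho S C : R, [/\ [/\ 0 < rho, 0 < S & 0 < C],
    forall z : V, `|z| < rho ->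
      [/\ Sigma (xi + z), 1 / 2 < |[xi + z]| & eta * |[xi + z]| < <<xi + z, xi>>],
    forall (s : R) (z : V), S <= s -> `|z| < rho -> T (s *: (xi + z)),
    forall (s t : R) (z z' : V), S <= s -> 0 <= t -> `|z| < rho -> `|z'| < rho ->
      `|rescaled_force s t z - rescaled_force s t z'| <= delta * `|z - z'| &
    forall (s t : R), S <= s -> 0 <= t ->
      `|rescaled_force s t 0| <= C * s `^ (alpha - beta)].
Proof.
move=> d0; have d20 : 0 < delta / 2 by rewrite divr_gt0.
have [C [K [C0 K0 HC]]] := decay_bounds mu0 r0 Wd.
have [rho1 rho10 H1] := near_xi mu0 xi1 oS Sxi eta1.
have [rho2 rho20 H2] := grad_remainder mu0 oS Sxi UC2 d20.
pose M := \sum_i (mu i)^-1.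
have M0 : 0 <= M by apply: sumr_ge0 => i _; rewrite invr_ge0 ltW.
have muM i : (mu i)^-1 <= M.
  by rewrite /M (bigD1 i)//= lerDl; apply: sumr_ge0 => j _; rewrite invr_ge0 ltW.
pose C2 := M * C * 2^-1 `^ (- beta - 2) * d%:R.
have C20 : 0 <= C2 by rewrite !mulr_ge0// ?powR_ge0// ltW.
have ab0 : alpha - beta < 0 by rewrite subr_lt0.
have e0 : 0 < delta / 2 / (C2 + 1) by rewrite divr_gt0// ltr_wpDl.
have [S1 S10 HS1] := powR_small ab0 e0.
pose S := S1 + 2 * r + 2 * K.
have big (s : R) : S <= s -> [/\ 0 < s, S1 <= s, 2 * r <= s & 2 * K < s].
  by move: S10 K0 r0; rewrite /S => *; split; lra.
pose rho := Num.min rho1 rho2.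
have rho0 : 0 < rho by rewrite lt_min rho10.
have rl1 z : z < rho -> z < rho1 by rewrite lt_min => /andP[].
have rl2 z : z < rho -> z < rho2 by rewrite lt_min => /andP[].
have coneP (s : R) (z : V) : S <= s -> `|z| < rho ->
    T (s *: (xi + z)) /\ K < |[s *: (xi + z)]|.
  move=> /big[s0 _ sr sK] zr; have [_ h1 h2] := H1 z (rl1 _ zr); split.
    exact: dilate_cone.
  rewrite mnormZ gtr0_norm//; move: sK s0 h1; nra.
have Sp (s : R) : S <= s -> 0 < s by move=> /big[].
have powE (s : R) : S <= s -> s `^ (alpha + 1) * (s `^ (- beta - 2) * s) = s `^ (alpha - beta).
  move=> /Sp s0; rewrite -{3}(powRr1 (ltW s0)) -!powRD ?(gt_eqF s0) ?implybT//.
  by congr (_ `^ _); ring.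
exists rho, S, C; split.
- by split => //; exact: Sp.
- by move=> z zr; apply: H1; exact: rl1.
- by move=> s z Ss zr; have [] := coneP s z Ss zr.
- move=> s t z z' Ss t0 zr zr'.
  have s0 := Sp s Ss.
  have WL : `|mgrad mu (W t) (s *: (xi + z)) - mgrad mu (W t) (s *: (xi + z'))|
      <= C2 * s `^ (- beta - 2) * (s * `|z - z'|).
    have E : s * `|z - z'| = `|s *: (xi + z) - s *: (xi + z')|.
      by rewrite -scalerBr normrZ gtr0_norm// opprD addrACA subrr add0r.
    rewrite E; pose m := M * C * (2^-1 `^ (- beta - 2) * s `^ (- beta - 2)).
    have m0 : 0 <= m by rewrite !mulr_ge0 ?powR_ge0// ltW.
    have inb (a : V) : `|a| < rho -> `|s *: (xi + a) - s *: xi| < s * rho.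
      move=> ar; rewrite -scalerBr normrZ gtr0_norm// ltr_pM2l//.
      by rewrite addrC addKr.
    have := @field_lipschitz R d (mgrad mu (W t)) 0 (s *: xi) (s * rho) m m0 _
      (s *: (xi + z')) (s *: (xi + z)) (inb _ zr') (inb _ zr).
    rewrite mul0mx subr0 => H; apply: le_trans (H _) _; last first.
      apply: ler_of_eq; rewrite /m /C2; ring.
    move=> y yx i j.
    pose a := s^-1 *: y - xi.
    have ya : y = s *: (xi + a).
      by rewrite /a addrC subrK scalerA mulfV ?gt_eqF// scale1r.
    have ar : `|a| < rho.
      rewrite -(ltr_pM2l s0) -{1}(gtr0_norm s0) -normrZ.
      by rewrite /a scalerBr scalerA mulfV ?gt_eqF// scale1r.
    have [Ty Ky] := coneP s a Ss ar; rewrite -ya in Ty Ky.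
    have [_ h2 _] := H1 a (rl1 _ ar).
    have [_ Hd] := HC t y t0 Ty Ky.
    have [g1 g2] := derive_mgrad_coord mu (@W_derivable t y i j t0 Ty).
    split => //; rewrite g2 mxE subr0 normrM gtr0_norm ?invr_gt0//.
    have sy : 2^-1 * s <= |[y]|.
      by rewrite ya mnormZ gtr0_norm// mulrC ler_pM2l//; have := h2; lra.
    have b2 : - beta - 2 <= 0 by have := ab; have := alpha0; lra.
    have s2 : 0 < 2^-1 * s by rewrite mulr_gt0// invr_gt0.
    have py := powR_antitone s2 sy b2.
    rewrite powRM ?invr_ge0 ?(ltW s0)// in py.
    have i0 : 0 <= (mu i)^-1 by rewrite invr_ge0 ltW.
    apply: le_trans (ler_pM i0 (normr_ge0 _) (muM i) (Hd i j)) _.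
    by rewrite /m -(mulrA M C); apply: (ler_wpM2l M0); rewrite ler_pM2l.
  rewrite /rescaled_force.
  set a := mgrad mu U _; set b := mgrad mu U xi; set a' := mgrad mu U (xi + z').
  set g := mgrad mu (W t) _; set g' := mgrad mu (W t) _.
  have -> : a - b - hess_mx mu U xi *m z + s `^ (alpha + 1) *: g -
     (a' - b - hess_mx mu U xi *m z' + s `^ (alpha + 1) *: g') =
     (a - a' - hess_mx mu U xi *m (z - z')) + s `^ (alpha + 1) *: (g - g').
    rewrite mulmxBr scalerBr !opprD !opprK.
    by apply/matrixP => i k; rewrite !mxE; ring.
  apply: le_trans (ler_normD _ _) _.
  have N := H2 z z' (rl2 _ zr) (rl2 _ zr').
  rewrite (splitr delta) mulrDl; apply: lerD; first exact: N.
  rewrite normrZ ger0_norm ?powR_ge0//.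
  apply: le_trans (ler_wpM2l (powR_ge0 _ _) WL) _.
  rewrite [leLHS](_ : _ = C2 * s `^ (alpha - beta) * `|z - z'|); last first.
    by rewrite -powE//; ring.
  apply: ler_wpM2r => //.
  have [_ sS1 _ _] := big s Ss.
  apply: le_trans (ler_wpM2l C20 (HS1 s sS1)) _.
  rewrite mulrCA -[leRHS]mulr1 ler_pM2l// ler_pdivrMr ?ltr_wpDl//.
  by rewrite mul1r lerDl.
- move=> s t Ss t0; rewrite /rescaled_force addr0 subrr mulmx0 subr0 add0r.
  have s0 := Sp s Ss.
  have [] := coneP s 0 Ss; rewrite ?normr0// addr0 => Ts Ks.
  have [+ _] := HC t (s *: xi) t0 Ts Ks.
  rewrite mnormZ xi1 mulr1 gtr0_norm// => H.
  rewrite normrZ ger0_norm ?powR_ge0//.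
  apply: le_trans (ler_wpM2l (powR_ge0 _ _) H) _.
  rewrite -powE// mulrCA ler_pM2l//.
  apply: ler_of_eq; congr (_ * _).
  rewrite -{3}(powRr1 (ltW s0)) -powRD ?(gt_eqF s0) ?implybT//.
  by congr (_ `^ _); ring.
Qed.

End Force.

(** * Logarithmic time and the asymptotics of the orbit *)

Section LogPosition.
Variables (R : realType) (d : nat).
Local Notation V := 'cV[R]_d.

(** The homothetic motion e^{kap x} xi perturbed by phi, in logarithmic time x. *)
Definition log_position (kap : R) (xi : V) (lam : R) (phi : R -> V) (x : R) : V :=
  lam *: (expR (kap * x) *: xi + phi x).

Lemma log_positionE (kap lam x : R) (xi : V) (phi : R -> V) :
  log_position kap xi lam phi x =
  (lam * expR (kap * x)) *: (xi + expR (- kap * x) *: phi x).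
Proof.
have EK : expR (kap * x) * expR (- kap * x) = 1 by rewrite -expRD mulNr subrr expR0.
by rewrite /log_position !scalerDr !scalerA -mulrA EK mulr1.
Qed.

End LogPosition.

Section LogTime.
Variables (R : realType) (d : nat).
Local Notation V := 'cV[R]_d.

Lemma is_derive_scaler (f : R -> R) (g : R -> V) (x df : R) (dg : V) :
  is_derive x 1 f df -> is_derive x 1 g dg ->
  is_derive x 1 (fun t => f t *: g t) (df *: g x + f x *: dg).
Proof.
move=> fd /is_derive_col gd; apply/is_derive_col => i.
have -> : (fun t => (f t *: g t) i 0) = (fun t => f t * g t i 0).
  by apply/funext => t; rewrite mxE.
by rewrite !mxE; exact: is_deriveMr fd (gd i).
Qed.

Lemma is_derive_comp_col (g : R -> V) (h : R -> R) (x dh : R) (dg : V) :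
  is_derive (h x) 1 g dg -> is_derive x 1 h dh ->
  is_derive x 1 (fun t => g (h t)) (dh *: dg).
Proof.
move=> /is_derive_col gd hd; apply/is_derive_col => i.
by rewrite mxE mulrC; exact: (@is_derive1_comp _ (fun t => g t i 0) h x _ _ (gd i) hd).
Qed.

Variables (t0 : R).
Hypothesis t00 : 0 < t0.

Definition log_time (t : R) : R := ln (1 + t / t0).

Lemma shift_gt0 (t : R) : 0 <= t -> 0 < 1 + t / t0.
Proof. by move=> t1; rewrite ltr_pwDl// divr_ge0// ltW. Qed.

Lemma log_time_ge0 (t : R) : 0 <= t -> 0 <= log_time t.
Proof. by move=> t1; apply: ln_ge0; rewrite lerDl divr_ge0// ltW. Qed.

Lemma expR_log_time (t : R) : 0 <= t -> expR (log_time t) = 1 + t / t0.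
Proof. by move=> t1; rewrite lnK// posrE shift_gt0. Qed.

Lemma log_timeK (t : R) : 0 <= t -> t0 * (expR (log_time t) - 1) = t.
Proof. by move=> t1; rewrite expR_log_time// addrC addKr mulrCA mulfV ?mulr1// gt_eqF. Qed.

Lemma is_derive_log_time (t : R) : 0 <= t ->
  is_derive t 1 log_time (expR (- log_time t) / t0).
Proof.
move=> t1; have h : is_derive t 1 (fun t : R => 1 + t / t0) (0 + t0^-1).
  apply: is_deriveD.
  rewrite (_ : (fun t : R => t / t0) = t0^-1 \*: id); last first.
    by apply/funext => s; rewrite /= mulrC.
  by rewrite -[X in is_derive _ _ _ X]mulr1; exact: is_deriveZ.
have h2 : is_derive (1 + t / t0) 1 (@ln R) (1 + t / t0)^-1.
  by apply: is_derive1_ln; exact: shift_gt0.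
have := @is_derive1_comp _ _ (fun t : R => 1 + t / t0) t _ _ h2 h; rewrite add0r.
by rewrite expRN expR_log_time.
Qed.

Lemma log_time_near (b : R) : \forall t \near +oo, 0 <= t /\ b <= log_time t.
Proof.
near=> t; have t1 : 0 <= t by near: t; exact: nbhs_pinfty_ge.
split => //; rewrite -ler_expR expR_log_time//.
have : t0 * expR b <= t by near: t; apply: nbhs_pinfty_ge; exact: num_real.
rewrite mulrC -ler_pdivlMr// => /le_trans; apply; by rewrite lerDr.
Unshelve. all: by end_near. Qed.

Lemma log_time_small (k A e : R) : 0 < k -> 0 < e ->
  \forall t \near +oo, A * expR (- k * log_time t) <= e.
Proof.
move=> k0 e0; have [b b0 Hb] := expR_small `|A| k0 e0.
apply: filterS (log_time_near b) => t [t1 bt].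
apply: le_trans Hb; apply: le_trans (ler_wpM2r (expR_ge0 _) (ler_norm A)) _.
by apply: ler_wpM2l => //; rewrite ler_expR !mulNr lerN2 ler_pM2l.
Qed.

Variables (lam kap : R) (xi : V) (phi chi f : R -> V).
Hypothesis lam0 : 0 < lam.
Hypotheses (dphi : forall x : R, -1 < x -> is_derive x 1 phi (chi x))
  (dchi : forall x : R, 0 <= x -> is_derive x 1 chi
    (chi x - (kap * (kap - 1) * expR (kap * x)) *: xi
       + (t0 ^+ 2 / lam * expR (2 * x)) *: f x)).

Definition orbit (t : R) : V := log_position kap xi lam phi (log_time t).

Definition orbit_velocity (t : R) : V :=
  (lam / t0 * expR (- log_time t)) *:
    ((kap * expR (kap * log_time t)) *: xi + chi (log_time t)).

Let pos1 (x : R) : 0 <= x -> -1 < x. Proof. by move=> x0; lra. Qed.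

Lemma is_derive_orbit (t : R) : 0 <= t -> is_derive t 1 orbit (orbit_velocity t).
Proof.
move=> t1; have x0 := log_time_ge0 t1.
have dl := is_derive_log_time t1.
have d1 (x : R) : is_derive x 1 (fun x => expR (kap * x) *: xi)
    ((kap * expR (kap * x)) *: xi).
  have := is_derive_scaler (is_derive_expRM kap x) (is_derive_cst xi x 1).
  by rewrite scaler0 addr0.
have d2 := is_deriveD (d1 (log_time t)) (dphi (pos1 x0)).
have := is_deriveZ lam (is_derive_comp_col d2 dl).
rewrite scalerA (_ : lam * _ = lam / t0 * expR (- log_time t))//.
by rewrite mulrCA mulrC.
Qed.

(** The hypothesis on chi is the equation of motion in logarithmic time: two time
    derivatives produce e^{-2 tau} (phi'' - phi' + kap (kap - 1) e^{kap tau} xi), up to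
    the factor lam / t0^2. *)
Lemma is_derive_orbit_velocity (t : R) : 0 <= t ->
  is_derive t 1 orbit_velocity (f (log_time t)).
Proof.
move=> t1; have x0 := log_time_ge0 t1.
have dl := is_derive_log_time t1.
pose g x := expR (-1 * x) *: ((kap * expR (kap * x)) *: xi + chi x).
have d1 (x : R) : is_derive x 1 (fun x => (kap * expR (kap * x)) *: xi)
    ((kap * (kap * expR (kap * x))) *: xi).
  have := is_derive_scaler (is_deriveZ kap (is_derive_expRM kap x)) (is_derive_cst xi x 1).
  by rewrite scaler0 addr0.
have d2 := is_deriveD (d1 (log_time t)) (dchi x0).
have d3 := is_derive_scaler (is_derive_expRM (-1) (log_time t)) d2.
have := is_deriveZ (lam / t0) (is_derive_comp_col d3 dl).
rewrite (_ : (lam / t0) \*: _ = orbit_velocity); last first.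
  by apply/funext => s; rewrite /orbit_velocity /= scalerA mulN1r.
rewrite (_ : _ *: (_ *: _) = f (log_time t))//.
set x := log_time t; set E := expR (kap * x); rewrite !mulN1r.
rewrite (_ : (_ + chi) x = (kap * E) *: xi + chi x)//.
have E2 : expR (2 * x) = (expR (- x))^-1 ^+ 2.
  by rewrite -expRN opprK expr2 -expRD; congr expR; ring.
have eN : expR (- x) != 0 by rewrite gt_eqF ?expR_gt0.
have tN : t0 != 0 by rewrite gt_eqF.
have lN : lam != 0 by rewrite gt_eqF.
rewrite E2; move: (expR (- x)) eN => q qN.
apply/matrixP => i j; rewrite !mxE; field.
by rewrite qN tN lN.
Qed.

End LogTime.

Section Asymptotics.
Variables (R : realType) (d : nat) (mu : 'I_d -> R).
Local Notation V := 'cV[R]_d.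
Local Notation "|[ x ]|" := (mnorm mu x).
Variables (t0 lam kap gm e M : R) (xi : V) (phi chi : R -> V).
Hypotheses (mu0 : forall j, 0 < mu j) (t00 : 0 < t0) (lam0 : 0 < lam)
  (gk : gm < kap) (k0 : 0 < kap) (k1 : kap < 1) (xi1 : |[xi]| = 1)
  (phie : weight_le gm phi e) (chiM : weight_le gm chi M).
Local Notation tau := (log_time t0).
Local Notation x := (orbit t0 lam kap xi phi).

(** The orbit divided by the homothetic factor; the correction vanishes at infinity
    because phi grows slower than e^{kap tau}. *)
Definition shape (t : R) : V := xi + expR (- kap * tau t) *: phi (tau t).

Lemma orbit_shape (t : R) : x t = (lam * expR (kap * tau t)) *: shape t.
Proof. exact: log_positionE. Qed.

Lemma shape_cvg : shape t @[t --> +oo] --> xi.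
Proof.
apply/(@cvgrPdist_le _ _ _ +oo _) => a a0.
have kg : 0 < kap - gm by rewrite subr_gt0.
have e0 := weight_le_ge0 phie.
apply: filterS2 (log_time_near t00 0) (log_time_small t00 e kg a0) => t [t1 x0] H.
rewrite /shape opprD addrA subrr sub0r normrN normrZ ger0_norm ?expR_ge0//.
apply: le_trans (ler_wpM2l (expR_ge0 _) (phie x0)) _.
apply: le_trans H; rewrite mulrCA -expRD.
by apply: ler_of_eq; congr (_ * expR _); ring.
Qed.

Lemma mnorm_shape_cvg : |[shape t]| @[t --> +oo] --> (1 : R).
Proof.
rewrite -xi1; apply: (@cvg_comp _ _ _ shape (mnorm mu) +oo (nbhs xi)).
  exact: shape_cvg.
exact: mnorm_continuous.
Qed.

Lemma mnorm_orbit (t : R) : |[x t]| = lam * expR (kap * tau t) * |[shape t]|.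
Proof.
by rewrite orbit_shape mnormZ ger0_norm// mulr_ge0 ?expR_ge0// ltW.
Qed.

Lemma orbit_direction_cvg : |[x t]|^-1 *: x t @[t --> +oo] --> xi.
Proof.
have E t : |[x t]|^-1 *: x t = |[shape t]|^-1 *: shape t.
  rewrite mnorm_orbit orbit_shape scalerA invfM mulrAC mulVf ?mul1r//.
  by rewrite gt_eqF// mulr_gt0// expR_gt0.
have c : |[shape t]|^-1 *: shape t @[t --> +oo] --> (1^-1 : R) *: xi.
  apply: cvgZ; last exact: shape_cvg.
  by apply: cvgV; [rewrite oner_eq0|exact: mnorm_shape_cvg].
rewrite invr1 scale1r in c.
by rewrite (eq_cvg _ _ E).
Qed.

Lemma orbit_unbounded : |[x t]| @[t --> +oo] --> +oo.
Proof.
apply/cvgryPge => A.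
have h2 : \forall t \near +oo, 1 / 2 <= |[shape t]|.
  have /cvgrPdist_le/(_ (1 / 2)) := mnorm_shape_cvg.
  rewrite divr_gt0// => /(_ isT); apply: filterS => t.
  by rewrite ler_norml => /andP[_]; lra.
apply: filterS2 h2 (log_time_small t00 (2 * A / lam) k0 ltr01) => t ht H.
rewrite mnorm_orbit; apply: (@le_trans _ _ (lam * expR (kap * tau t) * (1 / 2))).
  move: H; rewrite mulNr expRN ler_pdivrMr ?expR_gt0// mul1r ler_pdivrMr//.
  by rewrite mulrC; lra.
by apply: ler_wpM2l ht; rewrite mulr_ge0 ?expR_ge0// ltW.
Qed.

(** The velocity is O(e^{(kap - 1) tau}). *)
Lemma orbit_velocity_cvg :
  orbit_velocity t0 lam kap xi chi t @[t --> +oo] --> (0 : V).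
Proof.
apply/(@cvgrPdist_le _ _ _ +oo _) => a a0.
have kg : 0 < 1 - kap by rewrite subr_gt0.
have M0 := weight_le_ge0 chiM.
apply: filterS2 (log_time_near t00 0)
  (log_time_small t00 (lam / t0 * (kap * `|xi| + M)) kg a0) => t [t1 x0] H.
rewrite sub0r normrN /orbit_velocity normrZ.
have c0 : 0 <= lam / t0 by rewrite divr_ge0// ltW.
rewrite ger0_norm; last by rewrite mulr_ge0 ?expR_ge0.
have b1 : `|(kap * expR (kap * tau t)) *: xi + chi (tau t)| <=
    (kap * `|xi| + M) * expR (kap * tau t).
  apply: le_trans (ler_normD _ _) _; rewrite mulrDl; apply: lerD.
    by rewrite normrZ ger0_norm ?mulr_ge0 ?expR_ge0 ?(ltW k0)// mulrAC.
  apply: le_trans (chiM x0) _; apply: ler_wpM2l => //.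
  by rewrite ler_expR; apply: ler_wpM2r => //; exact: ltW.
have c1 : 0 <= lam / t0 * expR (- tau t) by rewrite mulr_ge0 ?expR_ge0.
apply: le_trans (ler_wpM2l c1 b1) _; apply: le_trans H.
have -> : expR (- (1 - kap) * tau t) = expR (- tau t) * expR (kap * tau t).
  by rewrite -expRD; congr expR; ring.
by apply: ler_of_eq; ring.
Qed.

(** The homothetic factor is lam e^{kap tau} = omega (t0 + t)^kap when
    lam = omega t0^kap. *)
Lemma orbit_growth (omega : R) : 0 < omega -> lam = omega * t0 `^ kap ->
  |[x t]| / (omega * t `^ kap) @[t --> +oo] --> (1 : R).
Proof.
move=> w0 lamE.
have c1 : (1 + t0 / t) `^ kap @[t --> +oo] --> (1 : R).
  have i1 : 1 + t0 / t @[t --> +oo] --> (1 : R).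
    apply/cvgrPdist_le => a a0.
    have h1 : \forall t \near +oo, (0 : R) < t by exact: nbhs_pinfty_gt.
    have h2 : \forall t \near +oo, t0 / a <= t.
      by apply: nbhs_pinfty_ge; exact: num_real.
    apply: filterS2 h1 h2 => t t1 ta.
    rewrite opprD addrA subrr sub0r normrN.
    rewrite ger0_norm; last by rewrite divr_ge0// ltW.
    by move: ta; rewrite !ler_pdivrMr// mulrC.
  suff : (1 + t0 / t) `^ kap @[t --> +oo] --> ((1 : R) `^ kap : R) by rewrite powR1.
  apply: (@cvg_comp _ _ _ (fun t => 1 + t0 / t) (fun y => y `^ kap) +oo (nbhs (1 : R))).
    exact: i1.
  exact: is_derive_continuous (is_derive1_powR kap ltr01).
have c2 : (1 + t0 / t) `^ kap * |[shape t]| @[t --> +oo] --> (1 * 1 : R).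
  by apply: cvgM; [exact: c1|exact: mnorm_shape_cvg].
rewrite mulr1 in c2.
apply: cvg_trans c2; apply: near_eq_cvg.
have tp : \forall t \near +oo, (0 : R) < t by exact: nbhs_pinfty_gt.
apply: filterS tp => t t1.
have t1' := ltW t1.
rewrite mnorm_orbit lamE.
rewrite (_ : expR (kap * tau t) = (1 + t / t0) `^ kap); last first.
  by rewrite mulrC expRM expR_log_time.
have tE : t0 * (1 + t / t0) = t * (1 + t0 / t).
  by field; rewrite !gt_eqF.
have p1 : t0 `^ kap * (1 + t / t0) `^ kap = t `^ kap * (1 + t0 / t) `^ kap.
  by rewrite -!powRM ?tE ?(ltW t00)// ?addr_ge0// ?divr_ge0// ltW.
have tkN : t `^ kap != 0 by rewrite gt_eqF// powR_gt0.
have wN : omega != 0 by rewrite gt_eqF.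
have -> : omega * t0 `^ kap * (1 + t / t0) `^ kap = omega * (t `^ kap * (1 + t0 / t) `^ kap).
  by rewrite -p1 mulrA.
by field; rewrite wN tkN.
Qed.

End Asymptotics.

(** * Existence in logarithmic time *)

Lemma continuous_pair (T U V : topologicalType) (f : T -> U) (g : T -> V) :
  continuous f -> continuous g -> continuous (fun x => (f x, g x)).
Proof. by move=> fc gc x; apply: cvg_pair; [exact: fc|exact: gc]. Qed.

Section ForceContinuity.
Variables (R : realType) (d : nat) (mu : 'I_d -> R).
Local Notation V := 'cV[R]_d.
Variables (alpha r eta : R) (Sigma : set V) (U : V -> R) (xi : V) (W : R -> V -> R).
Hypotheses (mu0 : forall j, 0 < mu j) (oS : open Sigma) (UC2 : Ck_on 2 Sigma U)
  (r0 : 0 < r)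
  (WC2 : Ck_on 2 (half_line R `*` cone_region mu xi r eta)
            (fun p : R * V => W p.1 p.2)).
Local Notation T := (cone_region mu xi r eta).

Lemma W_grad_comp (t : R -> R) (y : R -> V) : continuous t -> continuous y ->
  (forall x, 0 <= t x) -> (forall x, T (y x)) ->
  continuous (fun x => mgrad mu (W (t x)) (y x)).
Proof.
move=> tc yc t0 Ty.
apply: (@within_comp R _ _ (half_line R `*` T)
  (fun p : R * V => mgrad mu (W p.1) p.2) (fun x => (t x, y x))).
- exact: W_grad_continuous r0 WC2.
- exact: continuous_pair.
- by move=> x; split => //=; rewrite /half_line /= in_itv /= andbT.
Qed.

Lemma rescaled_force_continuous (s t : R -> R) (z : R -> V) :
  continuous s -> continuous t -> continuous z ->
  (forall x, 0 < s x) -> (forall x, 0 <= t x) -> (forall x, Sigma (xi + z x)) ->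
  (forall x, T (s x *: (xi + z x))) ->
  continuous (fun x => rescaled_force mu alpha U xi W (s x) (t x) (z x)).
Proof.
move=> sc tc zc s0 t0 Sz Tz x.
have yc : continuous (fun x => xi + z x).
  by move=> y; apply: cvgD; [exact: cvg_cst|exact: zc].
have c1 : {for x, continuous (fun x => mgrad mu U (xi + z x))}.
  apply: (@continuous_comp _ _ _ (fun x => xi + z x) (mgrad mu U)).
    exact: yc.
  exact: (@mgrad_continuous _ _ mu Sigma U oS UC2 _ (Sz x)).
have c2 : {for x, continuous (fun x => hess_mx mu U xi *m z x)}.
  apply: (@continuous_comp _ _ _ z (fun v => hess_mx mu U xi *m v)).
    exact: zc.
  exact: mulmx_continuous.
have c3 : continuous (fun x => mgrad mu (W (t x)) (s x *: (xi + z x))).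
  apply: (W_grad_comp tc _ t0 Tz) => y.
  by apply: cvgZ; [exact: sc|exact: yc].
have c4 : {for x, continuous (fun x => s x `^ (alpha + 1))}.
  apply: (@continuous_comp _ _ _ s (fun y => y `^ (alpha + 1))).
    exact: sc.
  exact: is_derive_continuous (is_derive1_powR (alpha + 1) (s0 x)).
apply: cvgD; last by apply: cvgZ; [exact: c4|exact: c3].
apply: cvgB; last exact: c2.
by apply: cvgB; [exact: c1|exact: cvg_cst].
Qed.

End ForceContinuity.

Section Constants.
Variables (R : realType) (alpha u : R).
Hypotheses (a0 : 0 < alpha) (a2 : alpha < 2) (u0 : 0 < u).

Definition kappa : R := 2 / (alpha + 2).
Definition Omega : R := (alpha + 2) ^+ 2 * u / 2.

Let a2N : alpha + 2 != 0. Proof. by rewrite gt_eqF// addr_gt0. Qed.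
Let a2p : 0 < alpha + 2. Proof. by rewrite addr_gt0. Qed.

(** This is where alpha < 2 enters: weights below 1/2 are negligible with respect to
    the homothetic growth e^{kappa tau}. *)
Lemma kappa_gt_half : 1 / 2 < kappa.
Proof. by rewrite /kappa ltr_pdivlMr//; have := a2; lra. Qed.

Lemma kappa_lt1 : kappa < 1.
Proof. by rewrite /kappa ltr_pdivrMr// mul1r ltrDr. Qed.

Lemma kappa_gt0 : 0 < kappa. Proof. by rewrite divr_gt0. Qed.

Lemma kappaM : kappa * (alpha + 2) = 2.
Proof. by rewrite /kappa mulfVK. Qed.

Lemma Omega_gt0 : 0 < Omega.
Proof. by rewrite /Omega divr_gt0// mulr_gt0// exprn_gt0. Qed.

Lemma Omega_neq0 : Omega != 0. Proof. by rewrite gt_eqF// Omega_gt0. Qed.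

(** With Omega = omega^{alpha + 2}, this is the equation for omega t^kappa xi to be a
    solution of the unperturbed problem. *)
Lemma kappa_Omega : kappa * (kappa - 1) = - (alpha * u / Omega).
Proof.
rewrite /kappa /Omega; field.
by rewrite a2N gt_eqF.
Qed.

(** The time at which the homothetic solution Omega^{1 / (alpha + 2)} t^kappa has
    norm lam. *)
Definition start_time (lam : R) : R := Num.sqrt (lam `^ (alpha + 2) / Omega).

Lemma start_time_gt0 lam : 0 < lam -> 0 < start_time lam.
Proof. by move=> l0; rewrite sqrtr_gt0 divr_gt0 ?powR_gt0 ?Omega_gt0. Qed.

Lemma start_time_sqr lam : 0 < lam -> start_time lam ^+ 2 = lam `^ (alpha + 2) / Omega.
Proof. by move=> l0; rewrite sqr_sqrtr// divr_ge0 ?powR_ge0// ltW// Omega_gt0. Qed.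

Lemma start_time_scale lam : 0 < lam ->
  lam = Omega `^ (1 / (alpha + 2)) * start_time lam `^ kappa.
Proof.
move=> l0.
have t0 := start_time_gt0 l0.
have -> : start_time lam `^ kappa = (lam `^ (alpha + 2) / Omega) `^ (1 / (alpha + 2)).
  rewrite -start_time_sqr// -powR_mulrn ?ltW// -powRrM; congr (_ `^ _).
  by rewrite /kappa; ring.
have O0 : 0 <= Omega by exact: ltW Omega_gt0.
have D0 : 0 <= lam `^ (alpha + 2) / Omega by exact: divr_ge0 (powR_ge0 _ _) O0.
rewrite -(powRM _ O0 D0).
rewrite mulrC divfK ?Omega_neq0// -powRrM mulrCA mulfV// mulr1 powRr1//.
exact: ltW.
Qed.

(** cs is a lower bound of the eigenvalues of B = H / Omega. Since
    Omega / 4 = (alpha + 2)^2 u / 8 and (alpha + 2)^2 - 8 alpha = (2 - alpha)^2, the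
    bound nu1 - alpha u > - Omega / 4 is the lower bound assumed on nu1, and
    kappa (alpha + 1 - beta) < 1/2 is the lower bound assumed on beta. So both the
    largest lower root and the growth rate of the perturbation lie strictly below
    1/2, and gm fits in between. *)
Lemma lower_gap (beta nu1 : R) : 4 * beta - 3 * alpha > 2 ->
  nu1 > - ((2 - alpha) ^+ 2 / 8) * u ->
  exists cs gm : R, [/\ - (1 / 4) < cs,
    forall c : R, c = (alpha + 1) * alpha * u \/ nu1 - alpha * u <= c ->
      cs <= c / Omega,
    (1 - Num.sqrt (1 + 4 * cs)) / 2 < gm, gm < 1 / 2 &
    kappa * (alpha + 1 - beta) <= gm].
Proof.
move=> hb hn.
have O0 := Omega_gt0.
pose cs := Num.min 0 ((nu1 - alpha * u) / Omega).
have cs4 : - (1 / 4) < cs.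
  rewrite /cs lt_min; apply/andP; split; first by lra.
  by rewrite ltr_pdivlMr//; move: hn; rewrite /Omega !expr2; lra.
have sq : 0 < Num.sqrt (1 + 4 * cs) by rewrite sqrtr_gt0; lra.
have kb : kappa * (alpha + 1 - beta) < 1 / 2.
  rewrite /kappa mulrAC ltr_pdivrMr//; move: hb; lra.
pose m := Num.max ((1 - Num.sqrt (1 + 4 * cs)) / 2) (kappa * (alpha + 1 - beta)).
have m1 : (1 - Num.sqrt (1 + 4 * cs)) / 2 <= m by rewrite /m le_max lexx.
have m2 : kappa * (alpha + 1 - beta) <= m by rewrite /m le_max lexx orbT.
have m3 : m < 1 / 2 by rewrite /m gt_max kb andbT; lra.
exists cs, ((m + 1 / 2) / 2); split => //; try by lra.
move=> c [->|h]; rewrite /cs ge_min; apply/orP.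
  by left; rewrite !mulr_ge0 ?invr_ge0 ?addr_ge0// ltW.
by right; rewrite ler_pM2r// invr_gt0.
Qed.

End Constants.

Section Existence.
Variables (R : realType) (d : nat) (mu : 'I_d -> R).
Local Notation V := 'cV[R]_d.
Local Notation "|[ x ]|" := (mnorm mu x).
Variables (alpha beta r eta nu1 : R) (Sigma : set V) (U : V -> R) (xi : V)
  (W : R -> V -> R).
Hypotheses (mu0 : forall j, 0 < mu j) (a0 : 0 < alpha) (a2 : alpha < 2)
  (oS : open Sigma)
  (coneS : forall (x : V) (l : R), Sigma x -> 0 < l -> Sigma (l *: x))
  (UC2 : Ck_on 2 Sigma U) (Upos : forall x, Sigma x -> 0 < U x)
  (Uhom : forall (x : V) (l : R), Sigma x -> 0 < l ->
     U (l *: x) = l `^ (- alpha) * U x)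
  (cc : central_configuration mu Sigma U xi)
  (hnu : smallest_ehess_eigenvalue mu U xi nu1)
  (BS : nu1 > - ((2 - alpha) ^+ 2 / 8) * U xi)
  (r0 : 0 < r) (eta1 : eta < 1)
  (WC2 : Ck_on 2 (half_line R `*` cone_region mu xi r eta)
            (fun p : R * V => W p.1 p.2))
  (hbeta : 4 * beta - 3 * alpha > 2)
  (Wd : uniform_decay mu (cone_region mu xi r eta) W beta).
Local Notation T := (cone_region mu xi r eta).
Local Notation kap := (kappa alpha).
Local Notation Om := (Omega alpha (U xi)).
Local Notation start := (start_time alpha (U xi)).
Local Notation force := (rescaled_force mu alpha U xi W).
Local Notation position := (log_position kap xi).

Definition log_force (lam : R) (phi : R -> V) (x : R) : V :=
  mgrad mu U (position lam phi x)
  + mgrad mu (W (start lam * (expR x - 1))) (position lam phi x).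

Let Sxi : Sigma xi. Proof. by case: cc. Qed.
Let xi1 : |[xi]| = 1. Proof. by case: cc. Qed.
Let u0 : 0 < U xi. Proof. exact: Upos. Qed.

(** Both sides split into the terms along xi, the terms in H p, which cancel against
    the linear part removed from the force, and the force itself. Homogeneity moves
    grad U from s (xi + z) to xi + z, and lam^{alpha + 2} = Omega t0^2 matches the
    constants. *)
Lemma force_identity (lam t x : R) (p : V) : 0 < lam ->
  Sigma (xi + expR (- kap * x) *: p) ->
  (Om^-1 *: hess_mx mu U xi) *m p + (Om^-1 * expR (kap * x)) *:
     force (lam * expR (kap * x)) t (expR (- kap * x) *: p)
  = - (kap * (kap - 1) * expR (kap * x)) *: xi
    + (start lam ^+ 2 / lam * expR (2 * x)) *:
      (mgrad mu U ((lam * expR (kap * x)) *: (xi + expR (- kap * x) *: p))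
       + mgrad mu (W t) ((lam * expR (kap * x)) *: (xi + expR (- kap * x) *: p))).
Proof.
move=> l0 Sy.
set y := xi + _ in Sy *; set s := lam * _; set E := expR (kap * x).
have E0 : 0 < E by exact: expR_gt0.
have s0 : 0 < s by rewrite mulr_gt0.
have sN : s != 0 by rewrite gt_eqF.
have EK : E * expR (- kap * x) = 1 by rewrite -expRD mulNr subrr expR0.
rewrite (grad_homogeneous mu oS UC2 Uhom Sy s0) /rescaled_force -/y.
rewrite (mgrad_xi mu0 oS UC2 Uhom cc).
have sc : start lam ^+ 2 / lam * expR (2 * x) = Om^-1 * E * s `^ (alpha + 1).
  rewrite start_time_sqr// /s powRM ?(ltW l0) ?expR_ge0//.
  have -> : expR (kap * x) `^ (alpha + 1) = expR (kap * (alpha + 1) * x).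
    by rewrite -expRM; congr expR; ring.
  have -> : expR (2 * x) = E * expR (kap * (alpha + 1) * x).
    by rewrite -expRD; congr expR; rewrite -(kappaM a0); ring.
  have -> : lam `^ (alpha + 2) = lam `^ (alpha + 1) * lam.
    rewrite -{3}(powRr1 (ltW l0)) -powRD ?(gt_eqF l0) ?implybT//.
    by congr (_ `^ _); ring.
  by field; rewrite Omega_neq0// gt_eqF.
have ss : s `^ (alpha + 1) * s `^ (- alpha - 1) = 1.
  by rewrite -powRD ?sN ?implybT// (_ : _ + _ = 0) ?powRr0//; ring.
rewrite sc (kappa_Omega a0 u0) -scalemxAl -scalemxAr.
have split_force (A g : V) : (Om^-1 * E * s `^ (alpha + 1)) *:
    (s `^ (- alpha - 1) *: A + g) =
    (Om^-1 * E) *: A + (Om^-1 * E * s `^ (alpha + 1)) *: g.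
  by rewrite scalerDr scalerA -[_ * s `^ (- alpha - 1)]mulrA ss mulr1.
rewrite split_force {split_force}.
move: (mgrad mu U y) (mgrad mu (W t) _) (hess_mx mu U xi *m p) => A g Hp.
have ON := Omega_neq0 a0 u0.
apply/matrixP => i j; rewrite !mxE.
have := congr1 (fun q => Om^-1 * q * Hp i j) EK; rewrite mulr1 => E1.
rewrite -E1; field.
exact: ON.
Qed.

(** The constants S, e, rho and gm are chosen before lam: the Lipschitz constant is
    imposed through rho1 and S1, the smallness of the perturbation along the
    homothetic motion through S2. Since gm < kap, the bound |phi| <= e e^{gm x} keeps
    e^{- kap x} phi in the ball around 0 where the force is controlled. *)
Lemma log_solution : exists S e rho gm : R,
  [/\ 0 < S, 0 < rho, gm < kap,
   (forall z : V, `|z| < rho -> Sigma (xi + z)) &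
   forall (lam : R) (phi0 : V), S <= lam -> `|phi0| < rho ->
   exists (phi chi : R -> V) (M : R),
   [/\ phi 0 = phi0, (forall x : R, -1 < x -> is_derive x 1 phi (chi x)),
     (forall x : R, 0 <= x -> is_derive x 1 chi
       (chi x - (kap * (kap - 1) * expR (kap * x)) *: xi
        + (start lam ^+ 2 / lam * expR (2 * x)) *: log_force lam phi x)),
     weight_le gm phi e /\ weight_le gm chi M &
     forall x : R, 0 <= x ->
       Sigma (position lam phi x) /\ T (position lam phi x)]].
Proof.
have O0 := Omega_gt0 a0 u0; have ON := Omega_neq0 a0 u0.
have k0 := kappa_gt0 a0; have k12 := kappa_gt_half a0 a2.
have [P [c [Pu HP cb]]] :=
  hess_mx_diagonalizable mu0 oS UC2 Uhom cc hnu.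
have [cs [gm [cs4 csb gm1 gm2 gmk]]] := lower_gap a0 u0 hbeta BS.
pose B := Om^-1 *: hess_mx mu U xi.
have BP : B *m P = P *m diag_mx (Om^-1 *: c).
  rewrite /B -scalemxAl HP scalemxAr; congr (_ *m _).
  by apply/matrixP => i j; rewrite !mxE mulrnAr.
have cb' i : cs <= (Om^-1 *: c) 0 i by rewrite mxE mulrC; exact: csb.
have gk : gm < kap by lra.
have [l l0 [s s0 HLP]] := euler_system Pu BP cs4 cb' gm1 gm2.
(* beta > (3 alpha + 2) / 4 > alpha because alpha < 2 *)
have ab : alpha < beta by move: a2 hbeta; lra.
have dl : 0 < Om * l by rewrite mulr_gt0.
have [rho1 [S1 [C [[rho0 S10 C0] H1 H2 H3 H4]]]] :=
  force_contraction mu0 oS Sxi xi1 UC2 r0 eta1 WC2 Wd a0 ab dl.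
(* half the radius, because the bound on phi at x = 0 is not strict *)
pose e := rho1 / 2.
have e0 : 0 < e by rewrite divr_gt0.
have er : e < rho1 by rewrite /e; lra.
have ab0 : alpha - beta < 0 by rewrite subr_lt0.
have q0 : 0 < Om * s * e / C by apply: divr_gt0 C0; apply: mulr_gt0 e0; exact: mulr_gt0.
have [S2 S20 HS2] := powR_small ab0 q0.
pose S := S1 + S2.
exists S, e, (Num.min rho1 (s * e)), gm; split => //.
- by rewrite addr_gt0.
- by rewrite lt_min rho0 mulr_gt0.
- by move=> z; rewrite lt_min => /andP[zr _]; have [] := H1 z zr.
move=> lam phi0 Sl; rewrite lt_min => /andP[_ /ltW phie].
have l1 : S1 <= lam by apply: le_trans Sl; rewrite /S lerDl ltW.
have l2 : S2 <= lam by apply: le_trans Sl; rewrite /S lerDr ltW.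
have lam0 : 0 < lam by exact: lt_le_trans l1.
have t0 : 0 < start lam by exact: start_time_gt0.
have sl (x : R) : 0 <= x -> lam <= lam * expR (kap * x).
  by move=> x0; rewrite ler_peMr ?(ltW lam0)// -expR0 ler_expR mulr_ge0// ltW.
have zl (x : R) (u : V) : 0 <= x -> `|u| <= e * expR (gm * x) ->
    `|expR (- kap * x) *: u| < rho1.
  move=> x0 ue; apply: le_lt_trans er; rewrite normrZ ger0_norm ?expR_ge0//.
  apply: le_trans (ler_wpM2l (expR_ge0 _) ue) _; rewrite mulrCA -expRD.
  rewrite -[leRHS]mulr1; apply: ler_wpM2l; first exact: ltW.
  rewrite -expR0 ler_expR -mulrDl mulr_le0_ge0// addrC subr_le0; exact: ltW.
have tl (x : R) : 0 <= x -> 0 <= start lam * (expR x - 1).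
  by move=> x0; rewrite mulr_ge0 ?(ltW t0)// subr_ge0 -expR0 ler_expR.
pose F (x : R) (u : V) := (Om^-1 * expR (kap * x)) *:
  force (lam * expR (kap * x)) (start lam * (expR x - 1)) (expR (- kap * x) *: u).
have [||||phi [chi [p0 dp dc pe [M cM]]]] := HLP F e phi0 (ltW e0).
- move=> g gc gw x.
  have cexp (k : R) : continuous (fun y : R => expR (k * clamp y)).
    move=> y; apply: (@continuous_comp _ _ _ (@clamp R) (fun y => expR (k * y))).
      exact: continuous_clamp.
    exact: continuous_expRM.
  have gcc : continuous (fun y : R => g (clamp y)).
    move=> y; apply: (@continuous_comp _ _ _ (@clamp R) g).
      exact: continuous_clamp.
    exact: gc.
  have zc : continuous (fun y : R => expR (- kap * clamp y) *: g (clamp y)).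
    by move=> y; apply: cvgZ; [exact: cexp|exact: gcc].
  have sc : continuous (fun y : R => lam * expR (kap * clamp y)).
    by move=> y; apply: cvgM; [exact: cvg_cst|exact: cexp].
  have tc : continuous (fun y : R => start lam * (expR (clamp y) - 1)).
    move=> y; apply: cvgM; first exact: cvg_cst.
    apply: cvgB; last exact: cvg_cst.
    apply: (@continuous_comp _ _ _ (@clamp R) (@expR R)).
      exact: continuous_clamp.
    exact: continuous_expR.
  have zr y : `|expR (- kap * clamp y) *: g (clamp y)| < rho1.
    by apply: zl; [exact: clamp_ge0|apply: gw; exact: clamp_ge0].
  apply: cvgZ; first by apply: cvgM; [exact: cvg_cst|exact: cexp].
  apply: (rescaled_force_continuous oS UC2 r0 WC2 sc tc zc) => y.
  - by rewrite mulr_gt0// expR_gt0.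
  - by apply: tl; exact: clamp_ge0.
  - by have [] := H1 _ (zr y).
  - apply: H2 (zr y); apply: le_trans l1 _; apply: sl; exact: clamp_ge0.
- move=> x u v x0 ue ve; rewrite /F -scalerBr normrZ.
  have E0 := expR_gt0 (kap * x).
  rewrite ger0_norm; last by rewrite mulr_ge0 ?invr_ge0 ?(ltW O0) ?expR_ge0.
  have := H3 (lam * expR (kap * x)) (start lam * (expR x - 1)) _ _
     (le_trans l1 (sl x x0)) (tl x x0) (zl x u x0 ue) (zl x v x0 ve).
  rewrite -scalerBr normrZ (ger0_norm (expR_ge0 _)) => H.
  apply: le_trans (ler_wpM2l _ H) _.
    by rewrite mulr_ge0 ?invr_ge0 ?(ltW O0) ?expR_ge0.
  have EK : expR (kap * x) * expR (- kap * x) = 1 by rewrite -expRD mulNr subrr expR0.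
  rewrite [leLHS](_ : _ = l * (expR (kap * x) * expR (- kap * x)) * `|u - v|).
    by rewrite EK mulr1.
  by field.
- move=> x x0; rewrite /F scaler0 normrZ.
  rewrite ger0_norm; last by rewrite mulr_ge0 ?invr_ge0 ?(ltW O0) ?expR_ge0.
  have := H4 (lam * expR (kap * x)) (start lam * (expR x - 1))
     (le_trans l1 (sl x x0)) (tl x x0) => H.
  apply: le_trans (ler_wpM2l _ H) _.
    by rewrite mulr_ge0 ?invr_ge0 ?(ltW O0) ?expR_ge0.
  rewrite powRM ?(ltW lam0) ?expR_ge0//.
  have -> : expR (kap * x) `^ (alpha - beta) = expR (kap * (alpha - beta) * x).
    by rewrite -expRM; congr expR; ring.
  have E1 : expR (kap * x) * expR (kap * (alpha - beta) * x) <= expR (gm * x).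
    rewrite -expRD ler_expR -mulrDl; apply: ler_wpM2r => //.
    by apply: le_trans gmk; apply: ler_of_eq; ring.
  have E2 : Om^-1 * (C * lam `^ (alpha - beta)) <= s * e.
    rewrite mulrC ler_pdivrMr// mulrC -ler_pdivlMr//.
    by apply: le_trans (HS2 lam l2) _; apply: ler_of_eq; field; rewrite gt_eqF.
  apply: le_trans (ler_pM _ _ E2 E1); last 2 first.
  + by rewrite !mulr_ge0 ?invr_ge0 ?powR_ge0 ?(ltW O0) ?(ltW C0).
  + by rewrite mulr_ge0 ?expR_ge0.
  by apply: ler_of_eq; ring.
- exact: phie.
have Sy (x : R) : 0 <= x -> Sigma (xi + expR (- kap * x) *: phi x).
  by move=> x0; have [] := H1 _ (zl x _ x0 (pe x x0)).
exists phi, chi, M; split => //.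
- move=> x x0; have x1 : -1 < x by lra.
  have := dc x x1; rewrite (clampE x0) -addrA /F (force_identity _ lam0 (Sy x x0)).
  by rewrite /log_force !log_positionE scaleNr addrA.
- move=> x x0; rewrite log_positionE; split.
    by apply: coneS; [exact: Sy|rewrite mulr_gt0// expR_gt0].
  by apply: H2; [exact: le_trans (sl x x0)|exact: zl (pe x x0)].
Qed.

End Existence.

(** * Parabolic solutions *)

Unset Implicit Arguments. Set Strict Implicit.

Theorem theorem1p1 (R : realType) (d : nat) (hd : (2 <= d)%N)
  (mu : 'I_d -> R) (hmu : forall j, 0 < mu j)
  (alpha : R) (halpha : 0 < alpha < 2)
  (Sigma : set 'cV[R]_d) (hSopen : open Sigma) (hS0 : ~ Sigma 0)
  (hScone : forall (x : 'cV[R]_d) (lambda : R),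
     Sigma x -> 0 < lambda -> Sigma (lambda *: x))
  (U : 'cV[R]_d -> R) (hUC3 : Ck_on 3 Sigma U)
  (hUpos : forall x, Sigma x -> 0 < U x)
  (hUhom : forall (x : 'cV[R]_d) (lambda : R), Sigma x -> 0 < lambda ->
     U (lambda *: x) = lambda `^ (- alpha) * U x)
  (xi : 'cV[R]_d) (hxi : central_configuration mu Sigma U xi)
  (nu1 : R) (hnu1 : smallest_ehess_eigenvalue mu U xi nu1)
  (hBS : nu1 > - ((2 - alpha) ^+ 2 / 8) * U xi)
  (r eta : R) (hr : 0 < r) (heta : 0 < eta < 1)
  (W : R -> 'cV[R]_d -> R)
  (hWC2 : Ck_on 2 (half_line R `*` cone_region mu xi r eta)
            (fun p : R * 'cV[R]_d => W p.1 p.2))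
  (beta : R) (hbeta : 4 * beta - 3 * alpha > 2)
  (hW : uniform_decay mu (cone_region mu xi r eta) W beta) :
  exists r' eta' : R,
    [/\ r <= r', eta <= eta' < 1,
        cone_region mu xi r' eta' `<=` Sigma &
        forall x0 : 'cV[R]_d, cone_region mu xi r' eta' x0 ->
        exists x : R -> 'cV[R]_d,
          [/\ solution mu (Sigma `&` cone_region mu xi r eta) U W x,
              parabolic mu x,
              x 0 = x0,
              (mnorm mu (x t))^-1 *: x t @[t --> +oo] --> xi &
              let omega :=
                ((alpha + 2) ^+ 2 * U xi / 2) `^ (1 / (alpha + 2)) in
              mnorm mu (x t) / (omega * t `^ (2 / (alpha + 2)))
                @[t --> +oo] --> (1 : R)]].
Proof.
have [a0 a2] : 0 < alpha /\ alpha < 2 by move/andP: halpha.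
have [eta0 eta1] : 0 < eta /\ eta < 1 by move/andP: heta.
have UC2 : Ck_on 2 Sigma U by exact: Ck_on_le.
have [xi1 Sxi _] := hxi.
have u0 := hUpos xi Sxi.
have [S [e [rho [gm [S0 rho0 gk HS Hsol]]]]] := log_solution hmu a0 a2 hSopen
  hScone UC2 hUpos hUhom hxi hnu1 hBS hr eta1 hWC2 hbeta hW.
have [etar etar1 Hcone] := cone_direction hmu xi1 rho0.
have ray (y : 'cV[R]_d) : 0 < mnorm mu y ->
    mnorm mu y *: (xi + ((mnorm mu y)^-1 *: y - xi)) = y.
  by move=> y0; rewrite addrC subrK scalerA mulfV ?scale1r// gt_eqF.
(* beyond norm S the solution exists for initial corrections smaller than rho;
   within the angle etar the correction x0 / |x0| - xi is that small *)
exists (Num.max r S), (Num.max eta etar); split.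
- by rewrite le_max lexx.
- by rewrite le_max lexx /= gt_max eta1.
- move=> y [/=]; rewrite !gt_max => /andP[ry _] /andP[_ ey].
  have y0 : 0 < mnorm mu y by exact: lt_trans ry.
  by have := hScone _ _ (HS _ (Hcone y y0 ey)) y0; rewrite ray.
move=> x0 [/=]; rewrite !gt_max => /andP[rx Sx] /andP[_ ex].
set lam := mnorm mu x0 in rx Sx ex *.
have lam0 : 0 < lam by exact: lt_trans rx.
have [phi [chi [M [p0 dphi dchi [pe cM] dom]]]] :=
  Hsol lam (lam^-1 *: x0 - xi) (ltW Sx) (Hcone x0 lam0 ex).
pose kap := kappa alpha; pose t0 := start_time alpha (U xi) lam.
have t00 : 0 < t0 by exact: start_time_gt0.
have k0 : 0 < kap by exact: kappa_gt0.
have k1 : kap < 1 by exact: kappa_lt1.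
pose x := orbit t0 lam kap xi phi.
pose x1 := orbit_velocity t0 lam kap xi chi.
pose x2 (t : R) := mgrad mu U (x (clamp t)) + mgrad mu (W (clamp t)) (x (clamp t)).
have xdom (t : R) : 0 <= t -> Sigma (x t) /\ cone_region mu xi r eta (x t).
  by move=> tge; exact: dom (log_time_ge0 t00 tge).
have d1 (t : R) : 0 <= t -> is_derive t 1 x (x1 t).
  by move=> tge; exact: is_derive_orbit.
have d2 (t : R) : 0 <= t -> is_derive t 1 x1 (x2 t).
  move=> tge; have := is_derive_orbit_velocity t00 lam0 dchi tge.
  by rewrite /log_force -/t0 log_timeK// /x2 clampE.
have xc : continuous (fun t => x (clamp t)).
  move=> t; apply: (@continuous_comp _ _ _ (@clamp R) x).
    exact: continuous_clamp.
  exact: is_derive_continuous (d1 _ (clamp_ge0 t)).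
have c2 : continuous x2.
  move=> t; apply: cvgD.
    apply: (@continuous_comp _ _ _ (fun t => x (clamp t)) (mgrad mu U)).
      exact: xc.
    exact: (@mgrad_continuous _ _ mu Sigma U hSopen UC2 _ (xdom _ (clamp_ge0 t)).1).
  apply: (W_grad_comp hr hWC2 (@continuous_clamp R) xc).
    exact: clamp_ge0.
  by move=> s; exact: (xdom _ (clamp_ge0 s)).2.
have [C2 T1 T2] := Ck2_half_line d1 d2 (fun t _ => c2 t).
exists x; split.
- split; first exact: C2.
  move=> t tge; split; first exact: xdom.
  by rewrite /time_derive T2// /x2 clampE.
- split; first exact: (orbit_unbounded t00 lam0 gk k0 xi1 pe).
  have v0 := orbit_velocity_cvg xi t00 lam0 gk k0 k1 cM.
  apply: cvg_trans v0; apply: near_eq_cvg.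
  apply: filterS (log_time_near t00 0) => t [tge _].
  by rewrite /time_derive T1.
- rewrite /x /orbit /log_position /log_time mul0r addr0 ln1 mulr0 expR0 scale1r p0.
  exact: ray.
- exact: (orbit_direction_cvg t00 lam0 gk xi1 pe).
- exact: (orbit_growth t00 lam0 gk xi1 pe (powR_gt0 _ (Omega_gt0 a0 u0)) (start_time_scale a0 u0 lam0)).
Qed.
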